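(* Let $\langle\cdot,\cdot\rangle=\langle\cdot,\cdot\rangle_{PSL(2,\mathbb{C})}$ be the holomorphic Riemannian metric on $PSL(2,\mathbb{C})$ which equals the left (equivalently right) translate of $\frac18 \mathrm{Kill}$, where $\mathrm{Kill}$ is the complex Killing form of $\mathfrak{sl}(2,\mathbb{C})$. Let $D$ be its Levi-Civita connection and $R$ the associated curvature tensor. Then: \begin{enumerate} \item If $X,Y$ are left-invariant vector fields on $PSL(2,\mathbb{C})$, then $D_XY=\frac12[X,Y]$. \item For all $V_1,V_2,V_3\in\mathfrak{sl}(2,\mathbb{C})=T_{I_2}PSL(2,\mathbb{C})$, $R(V_1,V_2)V_3=-\frac14[[V_1,V_2],V_3]$, where the brackets on the right are those of the Lie algebra $\mathfrak{sl}(2,\mathbb{C})$. \item For all $V_1,V_2\in\mathfrak{sl}(2,\mathbb{C})$, $\|[V_1,V_2]\|^2=-4\|V_1\|^2\|V_2\|^2+4\langle V_1,V_2\rangle^2$. \item $PSL(2,\mathbb{C})$ with the metric $\langle\cdot,\cdot\rangle_{PSL(2,\mathbb{C})}$, and $SL(2,\mathbb{C})$ with the pull-back metric $\langle\cdot,\cdot\rangle_{SL(2,\mathbb{C})}$, have constant (complex) sectional curvature $-1$. \end{enumerate}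
   Context: Holomorphic Riemannian metrics. Let $\mathbb{M}$ be a complex manifold with complex structure $\mathbb{J}$. A holomorphic Riemannian metric on $\mathbb{M}$ is a symmetric $(0,2)$-tensor $\langle\cdot,\cdot\rangle$ on $T\mathbb{M}$, with complex values, which is $\mathbb{C}$-bilinear ($\langle \mathbb{J}X,Y\rangle=\langle X,\mathbb{J}Y\rangle=i\langle X,Y\rangle$), non-degenerate at each point as a complex bilinear form, and such that $\langle X,Y\rangle$ is a holomorphic function for all local holomorphic vector fields $X,Y$. One writes $\|X\|^2:=\langle X,X\rangle$ (a complex number). Its Levi-Civita connection $D$ is the unique connection on $T\mathbb{M}$ which is compatible with the metric, $d\langle X,Y\rangle=\langle DX,Y\rangle+\langle X,DY\rangle$, and torsion free, $[X,Y]=D_XY-D_YX$, for all smooth vector fields $X,Y$. (It coincides with the Levi-Civita connections of the pseudo-Riemannian metrics $\mathrm{Re}\langle\cdot,\cdot\rangle$ and $\mathrm{Im}\langle\cdot,\cdot\rangle$.) The curvature tensor is $R(X,Y)Z=D_XD_YZ-D_YD_XZ-D_{[X,Y]}Z$. A non-degenerate plane of $T_p\mathbb{M}$ is a complex vector subspace of complex dimension $2$ on which $\langle\cdot,\cdot\rangle$ is non-degenerate. The complex sectional curvature of a non-degenerate plane $\mathrm{Span}_{\mathbb{C}}(V,W)$ is \[K(\mathrm{Span}_{\mathbb{C}}(V,W))=\frac{\langle R(V,W)W,V\rangle}{\|V\|^2\|W\|^2-\langle V,W\rangle^2}\in\mathbb{C}.\] Constant sectional curvature $k$ means that $K$ takes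 the value $k$ on all non-degenerate planes at all points. The metrics. $PSL(2,\mathbb{C})=SL(2,\mathbb{C})/\{\pm I_2\}$, with Lie algebra $\mathfrak{sl}(2,\mathbb{C})=\{M\in \mathrm{Mat}(2,\mathbb{C}) : \mathrm{tr}(M)=0\}=T_{I_2}PSL(2,\mathbb{C})$. The complex Killing form is $\mathrm{Kill}(M,N)=4\,\mathrm{tr}(MN)$. Let $L_A,R_A$ denote left and right translation by $A$. The metric on $PSL(2,\mathbb{C})$ is defined at $A\in PSL(2,\mathbb{C})$ by $\langle\cdot,\cdot\rangle_A:=\frac18(L_A)_*\mathrm{Kill}=\frac18(R_A)_*\mathrm{Kill}$, i.e. $\langle U,V\rangle_A=\frac18\mathrm{Kill}\big(d_A(L_A^{-1})U,\,d_A(L_A^{-1})V\big)$ for $U,V\in T_APSL(2,\mathbb{C})$; in particular at the identity $\langle M,N\rangle=\frac12\mathrm{tr}(MN)$ for $M,N\in\mathfrak{sl}(2,\mathbb{C})$. The metric $\langle\cdot,\cdot\rangle_{SL(2,\mathbb{C})}$ is its pull-back under the covering projection $SL(2,\mathbb{C})\to PSL(2,\mathbb{C})$. *)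

(* Defs.v *)
From HB Require Import structures.
From mathcomp Require Import all_boot all_order all_algebra.
From mathcomp Require Import complex.
From mathcomp Require Import all_classical all_reals all_analysis.

Set Implicit Arguments.
Unset Strict Implicit.
Unset Printing Implicit Defensive.

Import Order.TTheory GRing.Theory Num.Theory.
Import numFieldNormedType.Exports.

Local Open Scope classical_set_scope.
Local Open Scope ring_scope.
Local Open Scope complex_scope.

(* C^k and C^oo in the real sense, on an open subset O of a finite dimensional
   real normed space: f is C^(k+1) on O iff it is differentiable at every point
   of O and all its directional derivatives are C^k on O. *)
Fixpoint Ck (R : realType) (E : normedModType R) (k : nat) (O : set E)
    (f : E -> R) : Prop :=
  match k with
  | 0 => forall x, O x -> {for x, continuous f}
  | k'.+1 => (forall x, O x -> differentiable f x) /\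
             (forall v : E, Ck k' O (fun x => 'D_v f x))
  end.

Definition Coo (R : realType) (E : normedModType R) (O : set E) (f : E -> R) :
    Prop := forall k : nat, Ck k O f.

Section Groups.
Variable R : realType.
Local Notation C := R[i].
Local Notation M2 := 'M[C]_2.

(* M_2(C) as a real normed space, via A |-> (Re A, Im A). *)
Definition M2R : normedModType R := ('M[R]_2 * 'M[R]_2)%type.

Definition realify (A : M2) : M2R :=
  (map_mx (@complex.Re R) A, map_mx (@complex.Im R) A).

Definition SL2 := {A : M2 | \det A == 1}.

Lemma SL2_one_subproof : \det (1%:M : M2) == 1.
Proof. by rewrite det1. Qed.

Definition SL2_one : SL2 := Sub (1%:M : M2) SL2_one_subproof.

Lemma SL2_mul_subproof (A B : SL2) : \det (val A *m val B) == 1.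
Proof. by rewrite det_mulmx (eqP (valP A)) (eqP (valP B)) mulr1. Qed.

Definition SL2_mul (A B : SL2) : SL2 :=
  Sub (val A *m val B) (SL2_mul_subproof A B).

Definition sl2 : set M2 := [set M | \tr M = 0].

Definition lie (M N : M2) : M2 := M *m N - N *m M.

(* T_A SL(2,C) = d(L_A)(sl(2,C)) inside M_2(C). *)
Definition tangent (A : SL2) : set M2 := [set U | sl2 (invmx (val A) *m U)].

(* The two groups are treated uniformly as quotients of SL(2,C) by a group of
   deck transformations, trivial for SL and {A |-> A, A |-> -A} for PSL.
   Objects on PSL(2,C) = SL(2,C)/{I,-I} are represented by their lifts through
   the covering projection pi : SL(2,C) -> PSL(2,C), a local diffeomorphism:
   - a point [A] by any of its two representatives A, -A;
   - a function f by f o pi, i.e. by a function invariant under A |-> -A;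
   - T_[A] PSL(2,C) by T_A SL(2,C) via d_A pi, where U at A and -U at -A
     represent the same tangent vector;
   - a vector field by its pi-related lift, i.e. by a field X on SL(2,C)
     with X(-A) = -X(A).
   The lift of a tensor on PSL(2,C) is precisely its pull-back to SL(2,C). *)
Variant SLquotient := SL | PSL.

(* A and B are exchanged by a nontrivial deck transformation. *)
Definition deck (G : SLquotient) (A B : SL2) : Prop :=
  match G with
  | SL => False
  | PSL => val B = - val A
  end.

Definition local_extension (f : SL2 -> R) (A : SL2) : set (M2R -> R) :=
  [set g | exists O : set M2R,
     [/\ open O, O (realify (val A)), Coo O g &
         forall B : SL2, O (realify (val B)) -> g (realify (val B)) = f B]].

Definition smooth (f : SL2 -> R) : Prop :=
  forall A, exists g, local_extension f A g.

(* d_A f (U), computed with a chosen smooth local extension of f; for U tangent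
   at A the result does not depend on that choice. *)
Definition dfun (f : SL2 -> R) (A : SL2) (U : M2) : R :=
  'D_(realify U) (xget (fun=> 0) (local_extension f A)) (realify (val A)).

Definition dfunC (f : SL2 -> C) (A : SL2) (U : M2) : C :=
  dfun (fun B => complex.Re (f B)) A U +i* dfun (fun B => complex.Im (f B)) A U.

Definition smooth_function (G : SLquotient) (f : SL2 -> R) : Prop :=
  smooth f /\ forall A B, deck G A B -> f B = f A.

(* Real-smooth global vector fields; the deck transformation A |-> -A acts on
   tangent vectors, which are elements of M_2(C), by U |-> -U. *)
Definition vector_field (G : SLquotient) (X : SL2 -> M2) : Prop :=
  [/\ forall A, tangent A (X A),
      forall i j, smooth (fun A => complex.Re (X A i j)) /\
                  smooth (fun A => complex.Im (X A i j))
    & forall A B, deck G A B -> X B = - X A].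

Definition dfield (X : SL2 -> M2) (A : SL2) (U : M2) : M2 :=
  \matrix_(i, j) dfunC (fun B => X B i j) A U.

(* [X,Y] f = X (Y f) - Y (X f), evaluated on the matrix coordinates. *)
Definition bracket (X Y : SL2 -> M2) : SL2 -> M2 :=
  fun A => dfield Y A (X A) - dfield X A (Y A).

(* dL_B (X(A)) = X(B A) *)
Definition left_invariant (X : SL2 -> M2) : Prop :=
  forall A B : SL2, X (SL2_mul B A) = val B *m X A.

(* tr(ad M o ad N) on sl(2,C), which equals 4 tr(MN) there. *)
Definition kill (M N : M2) : C := 4 * \tr (M *m N).

(* Read at [A] for the metric on PSL(2,C), and at A for its pull-back to
   SL(2,C). *)
Definition metric (A : SL2) (U V : M2) : C :=
  8^-1 * kill (invmx (val A) *m U) (invmx (val A) *m V).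

Lemma SL2_unitmx (A : SL2) : val A \in unitmx.
Proof. by rewrite unitmxE (eqP (valP A)) unitr1. Qed.

Lemma metric_right (A : SL2) (U V : M2) :
  metric A U V = 8^-1 * kill (U *m invmx (val A)) (V *m invmx (val A)).
Proof.
rewrite /metric /kill -[in LHS]mulmxA [in LHS]mxtrace_mulC.
by rewrite !mulmxA.
Qed.

Lemma metric_deck (A B : SL2) (U V : M2) :
  val B = - val A -> metric B (- U) (- V) = metric A U V.
Proof.
move=> BA; rewrite /metric BA.
have -> : invmx (- val A) = - invmx (val A).
  have uA := SL2_unitmx A.
  have uNA : - val A \in unitmx by rewrite -BA SL2_unitmx.
  apply: (can_inj (mulKmx uNA)).
  by rewrite mulmxV // mulmxN mulNmx opprK mulmxV.
by rewrite !mulNmx !mulmxN !opprK.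
Qed.

Definition sqnorm (A : SL2) (U : M2) : C := metric A U U.

Definition connection (G : SLquotient)
    (D : (SL2 -> M2) -> (SL2 -> M2) -> SL2 -> M2) : Prop :=
  [/\ forall X Y, vector_field G X -> vector_field G Y ->
        vector_field G (D X Y),
      forall X X' Y, vector_field G X -> vector_field G X' ->
        vector_field G Y -> D (X \+ X') Y = D X Y \+ D X' Y,
      forall f X Y, smooth_function G f -> vector_field G X ->
        vector_field G Y ->
        D (fun A => (f A)%:C *: X A) Y = (fun A => (f A)%:C *: D X Y A),
      forall X Y Y', vector_field G X -> vector_field G Y ->
        vector_field G Y' -> D X (Y \+ Y') = D X Y \+ D X Y'
    & forall f X Y, smooth_function G f -> vector_field G X ->
        vector_field G Y ->
        D X (fun A => (f A)%:C *: Y A) =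
        (fun A => (dfun f A (X A))%:C *: Y A + (f A)%:C *: D X Y A)].

Definition levi_civita (G : SLquotient)
    (D : (SL2 -> M2) -> (SL2 -> M2) -> SL2 -> M2) : Prop :=
  [/\ connection G D,
      forall X Y Z, vector_field G X -> vector_field G Y -> vector_field G Z ->
        forall A, dfunC (fun B => metric B (Y B) (Z B)) A (X A) =
                  metric A (D X Y A) (Z A) + metric A (Y A) (D X Z A)
    & forall X Y, vector_field G X -> vector_field G Y ->
        forall A, bracket X Y A = D X Y A - D Y X A].

Definition curvature (D : (SL2 -> M2) -> (SL2 -> M2) -> SL2 -> M2)
    (X Y Z : SL2 -> M2) : SL2 -> M2 :=
  fun A => D X (D Y Z) A - D Y (D X Z) A - D (bracket X Y) Z A.

(* R_A(V1,V2)V3 = U, the value being the same for all extensions of V1, V2, V3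
   to vector fields. *)
Definition curvature_at (G : SLquotient)
    (D : (SL2 -> M2) -> (SL2 -> M2) -> SL2 -> M2)
    (A : SL2) (V1 V2 V3 U : M2) : Prop :=
  forall X1 X2 X3, vector_field G X1 -> vector_field G X2 ->
    vector_field G X3 -> X1 A = V1 -> X2 A = V2 -> X3 A = V3 ->
    curvature D X1 X2 X3 A = U.

Definition nondegenerate_plane (A : SL2) (P : {vspace M2}) : Prop :=
  [/\ \dim P = 2%N,
      forall U, U \in P -> tangent A U
    & forall U, U \in P -> (forall V, V \in P -> metric A U V = 0) -> U = 0].

Definition sectional_curvature (G : SLquotient)
    (D : (SL2 -> M2) -> (SL2 -> M2) -> SL2 -> M2)
    (A : SL2) (P : {vspace M2}) (k : C) : Prop :=
  forall V W : M2, <<[:: V; W]>>%VS = P ->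
    exists2 U, curvature_at G D A V W W U &
      metric A U V / (sqnorm A V * sqnorm A W - metric A V W ^+ 2) = k.

Definition constant_sectional_curvature (G : SLquotient)
    (D : (SL2 -> M2) -> (SL2 -> M2) -> SL2 -> M2) (k : C) : Prop :=
  forall (A : SL2) (P : {vspace M2}),
    nondegenerate_plane A P -> sectional_curvature G D A P k.

End Groups.

(* Main.v *)
(* The tangent space of SL(2,C) at A is spanned by the matrices A N with N
   nilpotent, and the line t |-> A + t A N stays in SL(2,C); hence the
   derivative of a smooth extension along a tangent vector depends only on its
   values on the group.
   The Levi-Civita connection has the closed form
     D_X Y = dY(X) - (X A^-1 Y + Y A^-1 X) / 2
   on all vector fields: the right-hand side is tangent, metric and torsion
   free, and two such connections differ by an expression S(X,Y) which is
   symmetric and for which <S(X,Y),Z> is skew in (Y,Z), hence which vanishes.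
   As the formula is not restricted to left-invariant fields, the curvature is
   obtained by differentiating it, without appeal to tensoriality; the second
   derivatives cancel because [X,Y] f = X(Y f) - Y(X f), which rests on the
   symmetry of second derivatives, and what remains is -[[x,y],z]/4 in terms of
   the left trivializations x = A^-1 X. *)

From HB Require Import structures.
Require Import Defs.
From mathcomp Require Import all_boot all_order all_algebra.
From mathcomp Require Import complex ring.
From mathcomp Require Import all_classical all_reals all_analysis.

Set Implicit Arguments.
Unset Strict Implicit.
Unset Printing Implicit Defensive.

Import Order.TTheory GRing.Theory Num.Theory.
Import numFieldNormedType.Exports.
Local Open Scope classical_set_scope.
Local Open Scope ring_scope.
Local Open Scope complex_scope.

(** * Symmetry of second derivatives *)

(** Used with [c] a mixed derivative at a nearby point, which identifies the two values at the point
    itself without passing to a limit. *)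
Lemma eq_of_close (K : realFieldType) (a b : K) :
  (forall e, 0 < e -> exists c, `|a - c| < e /\ `|b - c| < e) -> a = b.
Proof.
move=> H; apply/eqP; rewrite -subr_eq0 -normr_eq0 eq_le normr_ge0 andbT.
apply/ler_addgt0Pr => e e0; rewrite add0r.
have [c [ac bc]] := H (e / 2) (divr_gt0 e0 (ltr0Sn _ 1)).
apply: le_trans (ler_distD c _ _) _.
by rewrite [leRHS]splitr; apply: lerD; apply: ltW; rewrite // distrC.
Qed.

Section Calculus.
Variables (R : realType) (E : normedModType R).
Implicit Types (f g : E -> R) (O : set E) (k : nat).

Lemma is_derive_line f x v t : differentiable f (x + t *: v) ->
  is_derive t (1 : R) (fun s => f (x + s *: v)) ('D_v f (x + t *: v)).
Proof.
move=> df.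
have e : (fun h : R => h^-1 *: (((fun s => f (x + s *: v)) \o shift t) (h *: 1)
      - f (x + t *: v))) =
   (fun h : R => h^-1 *: ((f \o shift (x + t *: v)) (h *: v)
      - f (x + t *: v))).
  apply/funext => h /=; congr (_ *: (f _ - _)).
  by rewrite [_ *: 1]mulr1 scalerDl addrCA.
apply: DeriveDef.
  by rewrite /derivable e; exact: diff_derivable.
by rewrite /derive e.
Qed.

Lemma MVT_line f x v h : 0 < h ->
  (forall s, 0 <= s <= h -> differentiable f (x + s *: v)) ->
  exists2 s, 0 <= s <= h & f (x + h *: v) - f x = 'D_v f (x + s *: v) * h.
Proof.
move=> h0 df.
have d s : 0 <= s <= h ->
    is_derive s (1 : R) (fun s => f (x + s *: v)) ('D_v f (x + s *: v)).
  by move=> /df; exact: is_derive_line.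
have [] := @MVT R (fun s => f (x + s *: v))
  (fun s => 'D_v f (x + s *: v)) _ _ h0.
- move=> s; rewrite in_itv /= => /andP[/ltW s0 /ltW sh].
  by apply: d; rewrite s0 sh.
- apply: derivable_within_continuous => s; rewrite in_itv /= => sh.
  by have [] := d _ sh.
move=> s; rewrite in_itv /= scale0r addr0 subr0 => /andP[/ltW s0 /ltW sh] e.
by exists s => //; rewrite s0 sh.
Qed.

(** Two mean value theorems: the first along [u], for the increment of [f] over [h *: v], and the
    second along [v], for ['D_u f]. Up to the order of its terms the left-hand side is symmetric in
    [u] and [v]. *)
Lemma second_difference f x u v h : 0 < h ->
  (forall s t, 0 <= s <= h -> 0 <= t <= h ->
     differentiable f (x + s *: u + t *: v) /\
     differentiable ('D_u f) (x + s *: u + t *: v)) ->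
  exists s t, [/\ 0 <= s <= h, 0 <= t <= h &
    f (x + h *: u + h *: v) - f (x + h *: u) - f (x + h *: v) + f x =
    'D_v ('D_u f) (x + s *: u + t *: v) * h ^+ 2].
Proof.
move=> h0 df.
have hh : 0 <= h <= h by rewrite (ltW h0) lexx.
have h00 : (0 : R) <= (0 : R) <= h by rewrite lexx (ltW h0).
pose dF s := 'D_u f (x + s *: u + h *: v) - 'D_u f (x + s *: u).
have dE s : 0 <= s <= h -> is_derive s (1 : R)
   (fun s => f (x + s *: u + h *: v) - f (x + s *: u)) (dF s).
  move=> sh; apply: is_deriveB; last first.
    by apply: is_derive_line; have := (df s 0 sh h00).1; rewrite scale0r addr0.
  have -> : (fun s => f (x + s *: u + h *: v)) =
          (fun s => f ((x + h *: v) + s *: u)).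
    by apply/funext => r; rewrite addrAC.
  rewrite addrAC; apply: is_derive_line; rewrite addrAC.
  exact: (df s h sh hh).1.
have [] := @MVT R (fun s => f (x + s *: u + h *: v) - f (x + s *: u)) dF _ _ h0.
- move=> s; rewrite in_itv /= => /andP[/ltW s0 /ltW sh].
  by apply: dE; rewrite s0 sh.
- apply: derivable_within_continuous => s; rewrite in_itv /= => sh.
  by have [] := dE _ sh.
move=> s; rewrite in_itv /= scale0r addr0 subr0 => /andP[/ltW s0 /ltW sh] e.
have s0h : 0 <= s <= h by rewrite s0 sh.
have [t th e2] := @MVT_line ('D_u f) (x + s *: u) v h h0
  (fun t th => (df s t s0h th).2).
exists s, t; split=> //.
rewrite expr2 mulrA -e2 -/(dF s) -e; ring.
Qed.

(** The second difference over a small parallelogram at [x] is [h ^+ 2] times either mixed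
    derivative at some point of that parallelogram. Continuity brings both back to [x]. *)
Lemma derive_comm O f x u v : open O -> O x ->
  (forall y, O y -> differentiable f y) ->
  (forall w y, O y -> differentiable ('D_w f) y) ->
  (forall w z y, O y -> {for y, continuous ('D_w ('D_z f))}) ->
  'D_u ('D_v f) x = 'D_v ('D_u f) x.
Proof.
move=> oO Ox d1 d2 c2; apply: (@eq_of_close R) => e e0.
have nO : \forall y \near x, O y by apply: open_nbhs_nbhs; split.
have /cvgrPdist_lt/(_ _ e0) n1 := c2 u v _ Ox.
have /cvgrPdist_lt/(_ _ e0) n2 := c2 v u _ Ox.
have nn := filterI nO (filterI n1 n2).
have [r /= r0 Hr] := (nbhs_ballP _ _).1 (nn (nbhs_filter x) (nbhs_filter x)).
(* The summand 1 keeps [N] positive when [u] and [v] vanish. With [h] as below, every point of the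
   parallelogram is at distance less than [h * N = r / 2] from [x]. *)
pose N := `|u| + `|v| + 1.
have N0 : 0 < N by rewrite ltr_wpDl// addr_ge0.
pose h := r / N / 2.
have h0 : 0 < h by rewrite !divr_gt0.
have rN : r / N * N = r by rewrite divfK // gt_eqF.
have bl (w z : E) s t : `|w| + `|z| + 1 = N -> 0 <= s <= h -> 0 <= t <= h ->
    ball x r (x + s *: w + t *: z).
  move=> eN /andP[s0 sh] /andP[t0 th].
  rewrite -ball_normE /ball_ /= -addrA opprD addrA subrr add0r normrN.
  apply: le_lt_trans (ler_normD _ _) _; rewrite !normrZ !ger0_norm//.
  have : s * `|w| + t * `|z| <= h * (`|w| + `|z|).
    by rewrite mulrDr lerD // ler_wpM2r.
  move=> /le_lt_trans; apply.
  apply: (@lt_le_trans _ _ (h * N)); first by rewrite ltr_pM2l// -eN ltrDl.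
  by rewrite /h mulrAC rN ler_pdivrMr// mulr2n mulrDr mulr1 lerDl ltW.
have eN1 : `|u| + `|v| + 1 = N by [].
have eN2 : `|v| + `|u| + 1 = N by rewrite /N (addrC `|v|).
have df w z s t (eN : `|w| + `|z| + 1 = N) (sh : 0 <= s <= h)
    (th : 0 <= t <= h) :
    differentiable f (x + s *: w + t *: z) /\
    differentiable ('D_w f) (x + s *: w + t *: z).
  by have Op := (Hr _ (bl w z s t eN sh th)).1; split; [exact: d1|exact: d2].
have [s [t [sh th e3]]] :=
  second_difference h0 (fun s t sh th => df u v s t eN1 sh th).
have [s' [t' [sh' th' e4]]] :=
  second_difference h0 (fun s t sh th => df v u s t eN2 sh th).
have [_ [_ H2]] := Hr _ (bl u v s t eN1 sh th).
have [_ [H1 _]] := Hr _ (bl v u s' t' eN2 sh' th').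
(* This one number is also the other mixed derivative at another point of the parallelogram, hence
   close to both sides. *)
exists ('D_u ('D_v f) (x + s' *: v + t' *: u)); split; first exact: H1.
have hn0 : h ^+ 2 != 0 by rewrite expf_neq0 // gt_eqF.
suff <- : 'D_v ('D_u f) (x + s *: u + t *: v) =
          'D_u ('D_v f) (x + s' *: v + t' *: u) by exact: H2.
apply: (mulIf hn0); apply: etrans (esym e3) (etrans _ e4).
rewrite (addrAC x); congr (_ + _); exact: addrAC.
Qed.

End Calculus.

(** * Closure properties of C^k functions *)

Section Ck.
Variables (R : realType) (E : normedModType R).
Implicit Types (f g : E -> R) (O : set E) (k : nat).

Lemma near_eq_differentiable f g x : (\near x, f x = g x) ->
  differentiable f x -> differentiable g x.
Proof.
move=> fg df; apply/diffP.
(* The differential is a chosen linear map, so it suffices to exhibit one with the required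
   expansion; that of [f] has it. *)
apply: (@getPex _ (fun (dg : {linear E -> R}) => continuous dg /\
  forall y, g y = g (lim (nbhs x)) + dg (y - lim (nbhs x))
                  +o_(y \near x) (y - lim (nbhs x)))).
exists ('d f x); split; first exact: diff_continuous.
have [[_ fE]] := df.
suff gE : g = cst (g (lim (nbhs x))) + 'd f x \o center (lim (nbhs x))
  +o_x (center (lim (nbhs x))) by rewrite funeqE in gE.
have fgx : f x = g x := nbhs_singleton fg.
have {}fE := (eqaddoP _ _ _ _).1 fE; apply: (eqaddoP _ _ _ _).2 => eps eps0.
rewrite lim_id // in fE *.
apply: filterS2 fg (fE _ eps0) => y fgy.
by rewrite !fctE /= fgy fgx.
Qed.

Lemma open_near_eq O f g x : open O -> O x -> {in O, f =1 g} ->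
  \forall y \near x, f y = g y.
Proof.
move=> oO Ox fg; have : \forall y \near x, O y by apply: open_nbhs_nbhs; split.
by apply: filterS => y Oy; apply: fg; rewrite inE.
Qed.

Lemma open_eq_derive O f g : open O -> {in O, f =1 g} ->
  forall v, {in O, 'D_v f =1 'D_v g}.
Proof.
move=> oO fg v x; rewrite inE => Ox.
by apply: near_eq_derive; exact: (open_near_eq oO Ox fg).
Qed.

Lemma Ck_sub k O O' f : O' `<=` O -> Ck k O f -> Ck k O' f.
Proof.
move=> sO; elim: k f => [f H x /sO /H//|k IH f [df Df]].
by split=> [x /sO /df//|v]; exact: IH (Df v).
Qed.

(** On an open set continuity and directional derivatives are local, so values outside [O] do not
    matter. The sum and product rules need this, since they hold for the derivatives only on [O]. *)
Lemma Ck_eq k O f g : open O -> {in O, f =1 g} -> Ck k O f -> Ck k O g.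
Proof.
move=> oO; elim: k f g => [|k IH] f g fg /=.
  move=> cf x Ox; have fgx := open_near_eq oO Ox fg.
  rewrite /prop_for /continuous_at -(nbhs_singleton fgx).
  apply: cvg_trans (cf x Ox); exact: near_eq_cvg.
move=> [df Df]; split=> [x Ox|v].
  by apply: near_eq_differentiable (df x Ox); exact: (open_near_eq oO Ox fg).
by apply: IH (Df v); exact: open_eq_derive.
Qed.

Lemma CkW k O f : Ck k.+1 O f -> Ck k O f.
Proof.
elim: k f => [|k IH] f [df Df] /=.
  by move=> x Ox; exact/differentiable_continuous/df.
by split=> // v; exact: IH (Df v).
Qed.

Lemma Ck_cst k O (c : R) : Ck k O (fun=> c).
Proof.
elim: k c => [|k IH] c /=; first by move=> x _; exact: cvg_cst.
split=> [x _|v]; first exact: differentiable_cst.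
have -> : 'D_v (fun=> c : R) = fun=> 0; last exact: IH.
by apply/funext => x; exact: derive_cst.
Qed.

Lemma CkD k O f g : open O -> Ck k O f -> Ck k O g -> Ck k O (f + g).
Proof.
move=> oO; elim: k f g => [|k IH] f g /=.
  by move=> cf cg x Ox; apply: cvgD; [exact: cf|exact: cg].
move=> [df Df] [dg Dg]; split=> [x Ox|v].
  by apply: differentiableD; [exact: df|exact: dg].
apply: (@Ck_eq _ _ ('D_v f + 'D_v g)) => //; last exact: IH.
move=> x; rewrite inE => Ox.
by rewrite deriveD//; apply: diff_derivable; [exact: df|exact: dg].
Qed.

Lemma CkM k O f g : open O -> Ck k O f -> Ck k O g -> Ck k O (f * g).
Proof.
move=> oO; elim: k f g => [|k IH] f g.
  by move=> cf cg x Ox; apply: cvgM; [exact: cf|exact: cg].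
move=> Cf Cg; have [df Df] := Cf; have [dg Dg] := Cg.
split=> [x Ox|v].
  by apply: differentiableM; [exact: df|exact: dg].
apply: (@Ck_eq _ _ (f * 'D_v g + g * 'D_v f)) => //; last first.
  by apply: (CkD oO); apply: IH; 
    [exact: CkW|exact: (Dg v)|exact: CkW|exact: (Df v)].
move=> x; rewrite inE => Ox.
by rewrite deriveM//; apply: diff_derivable; [exact: df|exact: dg].
Qed.

Lemma Ck_linear k O (f : {linear E -> R}) : continuous f -> Ck k O f.
Proof.
move=> cf; case: k => [|k] /=; first by move=> x _; exact: cf.
split=> [x _|v]; first exact: linear_differentiable.
have -> : 'D_v f = fun=> f v; last exact: Ck_cst.
apply/funext => x; rewrite deriveE ?diff_lin//; exact: linear_differentiable.
Qed.

Lemma Coo_differentiable O f x : Coo O f -> O x -> differentiable f x.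
Proof. by move=> Cf Ox; have [df _] := Cf 1%N; exact: df. Qed.

Lemma Coo_derivable O f x v : Coo O f -> O x -> derivable f x v.
Proof. by move=> Cf Ox; exact/diff_derivable/(Coo_differentiable Cf). Qed.

Lemma Coo_derive O f v : Coo O f -> Coo O ('D_v f).
Proof. by move=> Cf k; have [_ Df] := Cf k.+1; exact: Df. Qed.

Lemma Coo_sub O O' f : O' `<=` O -> Coo O f -> Coo O' f.
Proof. by move=> sO Cf k; exact: Ck_sub (Cf k). Qed.

Lemma CooD O f g : open O -> Coo O f -> Coo O g -> Coo O (f + g).
Proof. by move=> oO Cf Cg k; exact: CkD. Qed.

Lemma CooM O f g : open O -> Coo O f -> Coo O g -> Coo O (f * g).
Proof. by move=> oO Cf Cg k; exact: CkM. Qed.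

Lemma Coo_derive_comm O f x u v : open O -> O x -> Coo O f ->
  'D_u ('D_v f) x = 'D_v ('D_u f) x.
Proof.
move=> oO Ox Cf; apply: (@derive_comm _ _ O f x u v oO Ox).
- by move=> y; exact: Coo_differentiable.
- by move=> w y; apply: Coo_differentiable; exact: Coo_derive.
- by move=> w z; have [_ /(_ z) [_ /(_ w)]] := Cf 2%N.
Qed.

Lemma derive_dirD f x u v : differentiable f x ->
  'D_(u + v) f x = 'D_u f x + 'D_v f x.
Proof. by move=> df; rewrite !deriveE// linearD. Qed.

Lemma derive_dirZ f x (a : R) v : differentiable f x ->
  'D_(a *: v) f x = a * 'D_v f x.
Proof. by move=> df; rewrite !deriveE// linearZ. Qed.

Lemma derive_dir_sum (I : finType) f x (v : I -> E) : differentiable f x ->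
  'D_(\sum_i v i) f x = \sum_i 'D_(v i) f x.
Proof.
move=> df; rewrite deriveE// linear_sum; apply: eq_bigr => i _.
by rewrite deriveE.
Qed.

End Ck.

(** * Derivatives along SL(2,C) *)

Section TwoByTwo.
Variable K : comNzRingType.
Implicit Types a b : 'M[K]_2.

Lemma big_ord2 (V : nmodType) (F : 'I_2 -> V) : \sum_(i < 2) F i = F 0 + F 1.
Proof. by rewrite big_ord_recl big_ord1; congr (_ + F _); exact: val_inj. Qed.

Lemma mulmx2E a b i j : (a *m b) i j = a i 0 * b 0 j + a i 1 * b 1 j.
Proof. by rewrite mxE big_ord2. Qed.

Lemma trmx2E a : \tr a = a 0 0 + a 1 1.
Proof. by rewrite /mxtrace big_ord2. Qed.

Lemma det2E a : \det a = a 0 0 * a 1 1 - a 0 1 * a 1 0.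
Proof.
rewrite (expand_det_row _ 0) big_ord2 /cofactor !det_mx11 !mxE /=.
rewrite expr0 expr1 mul1r mulN1r mulrN.
by congr (_ * a _ _ - _ * a _ _); exact: val_inj.
Qed.

Lemma mx2P a b : a 0 0 = b 0 0 -> a 0 1 = b 0 1 -> a 1 0 = b 1 0 ->
  a 1 1 = b 1 1 -> a = b.
Proof.
move=> e00 e01 e10 e11; apply/matrixP.
have o2 (i : 'I_2) : i = 0 \/ i = 1.
  by case: i => [[|[|//]] Hi]; [left|right]; exact: val_inj.
by move=> i j; case: (o2 i) => ->; case: (o2 j) => ->.
Qed.

End TwoByTwo.

(** * Real coordinates on M_2(C) *)

Section Realify.
Variable R : realType.
Local Notation M2 := 'M[R[i]]_2.
Implicit Types (U V : M2) (v : M2R R).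

Lemma realifyD U V : realify (U + V) = realify U + realify V.
Proof.
by congr (_, _); apply/matrixP => i j; rewrite !mxE;
  case: (U i j); case: (V i j).
Qed.

Lemma realifyZ (t : R) U : realify (t%:C *: U) = t *: realify U.
Proof.
by congr (_, _); apply/matrixP => i j; rewrite !mxE; case: (U i j) => a b /=;
  rewrite mul0r (subr0, addr0).
Qed.

Lemma realifyN U : realify (- U) = - realify U.
Proof.
by congr (_, _); apply/matrixP => i j; rewrite !mxE; case: (U i j).
Qed.

(** A single finite index type for all eight real coordinates allows a tangent vector to be expanded
    as one sum over [real_basis]. *)
Definition real_coord (k : bool * ('I_2 * 'I_2)) (v : M2R R) : R :=
  if k.1 then v.1 k.2.1 k.2.2 else v.2 k.2.1 k.2.2.

Definition real_basis (k : bool * ('I_2 * 'I_2)) : M2R R :=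
  if k.1 then (delta_mx k.2.1 k.2.2, 0) else (0, delta_mx k.2.1 k.2.2).

Lemma real_coord_linear k : linear (real_coord k : M2R R -> R).
Proof. by case: k => [[] [i j]] a u v; rewrite /real_coord /= !mxE. Qed.

HB.instance Definition _ k :=
  GRing.isLinear.Build R (M2R R) R _ (real_coord k) (real_coord_linear k).

Lemma real_coord_continuous k : continuous (real_coord k).
Proof.
by case: k => [[] [i j]] v;
  apply: (@continuous_comp _ _ _ _ (fun M : 'M[R]_2 => M i j));
  [exact: cvg_fst|exact: coord_continuous
  |exact: cvg_snd|exact: coord_continuous].
Qed.

Lemma real_coord_inj u v : (forall k, real_coord k u = real_coord k v) -> u = v.
Proof.
case: u v => [a b] [c d] e; congr (_, _); apply/matrixP => i j.
  exact: (e (true, (i, j))).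
exact: (e (false, (i, j))).
Qed.

Lemma real_coord_basis k l : real_coord k (real_basis l) = (k == l)%:R.
Proof.
by case: k l => [[] [i j]] [[] [i' j']]; rewrite /real_coord /= !mxE.
Qed.

Lemma real_coord_sum v : v = \sum_k real_coord k v *: real_basis k.
Proof.
apply: real_coord_inj => k; rewrite linear_sum (bigD1 k) //= linearZ /=.
rewrite real_coord_basis.
rewrite eqxx [_ *: _]mulr1 big1 ?addr0// => l lk.
by rewrite linearZ /= real_coord_basis eq_sym (negbTE lk) scaler0.
Qed.

Lemma realify_line (A U : M2) (t : R) :
  realify (A + t%:C *: U) = t *: realify U + realify A.
Proof. by rewrite realifyD realifyZ addrC. Qed.

End Realify.

(** * Independence of the derivative from the local extension *)

Section Extension.
Variable R : realType.
Local Notation M2 := 'M[R[i]]_2.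
Implicit Types (A B : SL2 R) (U V : M2) (f : SL2 R -> R) (g : M2R R -> R).

(** In size two the determinant is [1 + z * \tr N + z ^+ 2 * \det N]. *)
Lemma det_nilpotent_line (N : M2) (z : R[i]) : \tr N = 0 -> \det N = 0 ->
  \det (1%:M + z *: N) = 1.
Proof.
rewrite !det2E trmx2E !mxE /= => t0 d0.
have e : N 1 1 = - N 0 0 by apply/eqP; rewrite -addr_eq0 addrC t0.
move: d0; rewrite e => d0.
transitivity (1 + z ^+ 2 * (N 0 0 * - N 0 0 - N 0 1 * N 1 0)); last first.
  by rewrite d0 mulr0 addr0.
by rewrite !mulr0n !mulr1n; ring.
Qed.

Lemma traceless_nilpotent_sum (u : M2) : \tr u = 0 -> exists N1 N2 N3 : M2,
  [/\ u = N1 + N2 + N3, \tr N1 = 0 /\ \det N1 = 0,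
      \tr N2 = 0 /\ \det N2 = 0 & \tr N3 = 0 /\ \det N3 = 0].
Proof.
rewrite trmx2E => t0.
have e : u 1 1 = - u 0 0 by apply/eqP; rewrite -addr_eq0 addrC t0.
pose mk (a b c d : R[i]) : M2 := \matrix_(i, j)
  if i == 0 then if j == 0 then a else b else if j == 0 then c else d.
(* The first summand carries the diagonal of [u], with off-diagonal entries that make it nilpotent;
   the two strictly triangular summands correct those entries. *)
exists (mk (u 0 0) (- u 0 0) (u 0 0) (- u 0 0)), (mk 0 (u 0 1 + u 0 0) 0 0),
  (mk 0 0 (u 1 0 - u 0 0) 0); rewrite !trmx2E !det2E !mxE /=.
by split; [apply: mx2P; rewrite !mxE /= ?e|..]; try split; ring.
Qed.

(** The difference of two local extensions of the same function is of this kind. *)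
Definition zero_on_SL2 g A := exists O : set (M2R R),
  [/\ open O, O (realify (val A)), Coo O g &
      forall B, O (realify (val B)) -> g (realify (val B)) = 0].

Lemma zero_on_SL2_derive g A U : zero_on_SL2 g A -> tangent A U ->
  'D_(realify U) g (realify (val A)) = 0.
Proof.
move=> [Q [oO OA Cg g0]] /traceless_nilpotent_sum[N1 [N2 [N3 [e n1 n2 n3]]]].
have uA := SL2_unitmx A.
have nil N : \tr N = 0 /\ \det N = 0 ->
    'D_(realify (val A *m N)) g (realify (val A)) = 0.
  move=> [tN dN].
  have dA t : \det (val A + t%:C *: (val A *m N)) == 1.
    rewrite -[X in X + _]mulmx1 scalemxAr -mulmxDr det_mulmx.
    by rewrite det_nilpotent_line // mulr1 (valP A).
  (* The line lies in the group for all [t], but [g] is controlled only on [Q], so small [t] are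
     needed. *)
  have nO : \forall t \near (0 : R),
      Q (t *: realify (val A *m N) + realify (val A)).
    have c : {for (0 : R), continuous (fun t : R =>
        t *: realify (val A *m N) + realify (val A) : M2R R)}.
      by apply: cvgD; [exact: cvgZr_tmp|exact: cvg_cst].
    apply: c; rewrite scale0r add0r; exact: open_nbhs_nbhs.
  (* Near [t = 0] both values in the difference quotient are zero, so the quotient is constant
     there. *)
  rewrite /derive; apply: cvg_lim => //.
  apply: cvg_near_cst; apply: cvg_within; near=> t.
  rewrite /= -realify_line.
  have -> : g (realify (val A)) = 0 by exact: g0.
  suff -> : g (realify (val A + t%:C *: (val A *m N))) = 0.
    by rewrite subrr scaler0.
  apply: (g0 (Sub (val A + t%:C *: (val A *m N)) (dA t) : SL2 R)).
  by rewrite SubK realify_line; near: t.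
have -> : U = val A *m (N1 + N2 + N3) by rewrite -e mulKVmx.
have dg := Coo_differentiable Cg OA.
by rewrite !mulmxDr !realifyD !derive_dirD // !nil // !addr0.
Unshelve. all: by end_near. Qed.

(** This makes [dfun] computable from any convenient extension: the chosen one differs from [g] by a
    function vanishing on the group, whose tangential derivatives are zero. *)
Lemma dfunE f A U g : local_extension f A g -> tangent A U ->
  dfun f A U = 'D_(realify U) g (realify (val A)).
Proof.
move=> eg tU; rewrite /dfun.
set h := xget _ _; have eh : local_extension f A h.
  by apply: xgetPex; exists g.
have [Q [oO OA Cg gf]] := eg; have [Q' [oO' OA' Ch hf]] := eh.
have oI : open (Q `&` Q') by exact: openI.
have CgI : Coo (Q `&` Q') g by apply: Coo_sub Cg => ? [].
have ChI : Coo (Q `&` Q') h by apply: Coo_sub Ch => ? [].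
have OAI : (Q `&` Q') (realify (val A)) by split.
have CN1 : Coo (Q `&` Q') (fun=> -1 : R) by move=> k; exact: Ck_cst.
have z : zero_on_SL2 (h + (fun=> -1) * g) A.
  exists (Q `&` Q'); split => //; first by apply: CooD => //; exact: CooM.
  by move=> B [OB OB']; rewrite !fctE gf // hf // mulN1r subrr.
have := zero_on_SL2_derive z tU; rewrite deriveD; last 2 first.
- exact: Coo_derivable ChI OAI.
- by apply: (@Coo_derivable _ _ (Q `&` Q')) => //; exact: CooM.
rewrite deriveM; last 2 first.
- exact: Coo_derivable CN1 OAI.
- exact: Coo_derivable CgI OAI.
have -> : 'D_(realify U) ((fun=> -1) : M2R R -> R) (realify (val A)) = 0.
  exact: derive_cst.
by rewrite scaler0 addr0 scaleN1r => /eqP; rewrite subr_eq0 => /eqP.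
Qed.

End Extension.

(** * Differentiation rules for smooth functions on the group *)

Section Smooth.
Variable R : realType.
Local Notation M2 := 'M[R[i]]_2.
Implicit Types (A B : SL2 R) (U V : M2) (f : SL2 R -> R) (g : M2R R -> R).

Lemma local_extension_eq f f' A g (Q : set (M2R R)) : open Q ->
  Q (realify (val A)) -> (forall B, Q (realify (val B)) -> f B = f' B) ->
  local_extension f A g -> local_extension f' A g.
Proof.
move=> oQ QA ff' [P [oP PA Cg gf]]; exists (Q `&` P); split=> //.
- exact: openI.
- by apply: Coo_sub Cg => ? [].
- by move=> B [QB PB]; rewrite -ff' // gf.
Qed.

Lemma local_extension_cst A (c : R) :
  local_extension (fun=> c) A (fun=> c).
Proof. by exists setT; split=> //; [exact: openT|move=> k; exact: Ck_cst]. Qed.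

Lemma local_extensionD f1 f2 A g1 g2 : local_extension f1 A g1 ->
  local_extension f2 A g2 -> local_extension (fun B => f1 B + f2 B) A (g1 + g2).
Proof.
move=> [P [oP PA Cg1 gf1]] [Q [oQ QA Cg2 gf2]]; exists (P `&` Q); split=> //.
- exact: openI.
- by apply: CooD; [exact: openI|apply: Coo_sub Cg1|apply: Coo_sub Cg2];
    move=> ? [].
- by move=> B [PB QB]; rewrite fctE gf1 // gf2.
Qed.

Lemma local_extensionM f1 f2 A g1 g2 : local_extension f1 A g1 ->
  local_extension f2 A g2 -> local_extension (fun B => f1 B * f2 B) A (g1 * g2).
Proof.
move=> [P [oP PA Cg1 gf1]] [Q [oQ QA Cg2 gf2]]; exists (P `&` Q); split=> //.
- exact: openI.
- by apply: CooM; [exact: openI|apply: Coo_sub Cg1|apply: Coo_sub Cg2];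
    move=> ? [].
- by move=> B [PB QB]; rewrite fctE gf1 // gf2.
Qed.

Lemma local_extension_sum (I : finType) (F : I -> SL2 R -> R)
    (G : I -> M2R R -> R) A : (forall i, local_extension (F i) A (G i)) ->
  local_extension (fun B => \sum_i F i B) A (\sum_i G i).
Proof.
move=> FG; elim: (index_enum I) => [|i s IH].
  rewrite big_nil (_ : (fun B => _) = fun=> 0).
    exact: (local_extension_cst A 0).
  by apply/funext => B; rewrite big_nil.
rewrite big_cons (_ : (fun B => _) = fun B => F i B + \sum_(j <- s) F j B).
  exact: (local_extensionD (FG i) IH).
by apply/funext => B; rewrite big_cons.
Qed.

Lemma local_extension_real_coord k A :
  local_extension (fun B => real_coord k (realify (val B))) A (real_coord k).
Proof.
exists setT; split=> //; first exact: openT.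
move=> n; exact/Ck_linear/real_coord_continuous.
Qed.

Lemma local_extension_differentiable f A g : local_extension f A g ->
  differentiable g (realify (val A)).
Proof. by move=> [Q [_ QA Cg _]]; exact: Coo_differentiable Cg QA. Qed.

Lemma local_extension_derivable f A g v : local_extension f A g ->
  derivable g (realify (val A)) v.
Proof. by move=> /local_extension_differentiable; exact: diff_derivable. Qed.

Lemma local_extension_at f A g : local_extension f A g ->
  g (realify (val A)) = f A.
Proof. by move=> [Q [_ QA _ gf]]; exact: gf. Qed.

Lemma smooth_cst (c : R) : smooth (fun=> c : R).
Proof. by move=> A; exists (fun=> c); exact: local_extension_cst. Qed.

Lemma smooth_real_coord k :
  smooth (fun B : SL2 R => real_coord k (realify (val B))).
Proof.
move=> A; exists (real_coord k); exact: local_extension_real_coord.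
Qed.

Lemma smoothD f1 f2 : smooth f1 -> smooth f2 -> smooth (fun B => f1 B + f2 B).
Proof.
move=> s1 s2 A; have [g1 e1] := s1 A; have [g2 e2] := s2 A.
by exists (g1 + g2); exact: local_extensionD.
Qed.

Lemma smoothM f1 f2 : smooth f1 -> smooth f2 -> smooth (fun B => f1 B * f2 B).
Proof.
move=> s1 s2 A; have [g1 e1] := s1 A; have [g2 e2] := s2 A.
by exists (g1 * g2); exact: local_extensionM.
Qed.

Lemma smooth_eq f1 f2 : f1 =1 f2 -> smooth f1 -> smooth f2.
Proof. by move=> /funext ->. Qed.

Lemma smoothN f : smooth f -> smooth (fun B => - f B).
Proof.
move=> sf; apply: (@smooth_eq (fun B => -1 * f B)).
  by move=> B; rewrite mulN1r.
by apply: smoothM sf; exact: smooth_cst.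
Qed.

Lemma dfun_cst A U (c : R) : tangent A U -> dfun (fun=> c) A U = 0.
Proof.
move=> tU; rewrite (dfunE (local_extension_cst A c) tU).
exact: derive_cst.
Qed.

Lemma dfun_real_coord A U k : tangent A U ->
  dfun (fun B => real_coord k (realify (val B))) A U = real_coord k (realify U).
Proof.
move=> tU; rewrite (dfunE (local_extension_real_coord k A) tU).
by rewrite deriveE ?diff_lin //;
  [exact: real_coord_continuous
  |exact/linear_differentiable/real_coord_continuous].
Qed.

Lemma dfunD f1 f2 A U : smooth f1 -> smooth f2 -> tangent A U ->
  dfun (fun B => f1 B + f2 B) A U = dfun f1 A U + dfun f2 A U.
Proof.
move=> /(_ A)[g1 e1] /(_ A)[g2 e2] tU.
rewrite (dfunE (local_extensionD e1 e2) tU) (dfunE e1 tU) (dfunE e2 tU).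
by rewrite deriveD //; [exact: local_extension_derivable e1|
  exact: local_extension_derivable e2].
Qed.

Lemma dfunM f1 f2 A U : smooth f1 -> smooth f2 -> tangent A U ->
  dfun (fun B => f1 B * f2 B) A U = f1 A * dfun f2 A U + f2 A * dfun f1 A U.
Proof.
move=> /(_ A)[g1 e1] /(_ A)[g2 e2] tU.
rewrite (dfunE (local_extensionM e1 e2) tU) (dfunE e1 tU) (dfunE e2 tU).
rewrite deriveM ?(local_extension_at e1) ?(local_extension_at e2) //.
  exact: local_extension_derivable e1.
exact: local_extension_derivable e2.
Qed.

Lemma dfunN f A U : smooth f -> tangent A U ->
  dfun (fun B => - f B) A U = - dfun f A U.
Proof.
move=> sf tU; have -> : (fun B => - f B) = (fun B => -1 * f B).
  by apply/funext => B; rewrite mulN1r.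
rewrite dfunM ?dfun_cst //; last exact: smooth_cst.
by rewrite mulr0 addr0 mulN1r.
Qed.

Definition smoothC (f : SL2 R -> R[i]) :=
  smooth (fun B => complex.Re (f B)) /\ smooth (fun B => complex.Im (f B)).

Implicit Types F : SL2 R -> R[i].

Lemma ReD (x y : R[i]) : complex.Re (x + y) = complex.Re x + complex.Re y.
Proof. by case: x; case: y. Qed.

Lemma ImD (x y : R[i]) : complex.Im (x + y) = complex.Im x + complex.Im y.
Proof. by case: x; case: y. Qed.

Lemma ReM (x y : R[i]) : complex.Re (x * y) =
  complex.Re x * complex.Re y + - (complex.Im x * complex.Im y).
Proof. by case: x; case: y. Qed.

Lemma ImM (x y : R[i]) : complex.Im (x * y) =
  complex.Re x * complex.Im y + complex.Im x * complex.Re y.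
Proof. by case: x; case: y. Qed.

Let funReD F1 F2 : (fun B => complex.Re (F1 B + F2 B)) =
  (fun B => complex.Re (F1 B) + complex.Re (F2 B)).
Proof. by apply/funext => B; rewrite ReD. Qed.

Let funImD F1 F2 : (fun B => complex.Im (F1 B + F2 B)) =
  (fun B => complex.Im (F1 B) + complex.Im (F2 B)).
Proof. by apply/funext => B; rewrite ImD. Qed.

Let funReM F1 F2 : (fun B => complex.Re (F1 B * F2 B)) =
  (fun B => complex.Re (F1 B) * complex.Re (F2 B)
            + - (complex.Im (F1 B) * complex.Im (F2 B))).
Proof. by apply/funext => B; rewrite ReM. Qed.

Let funImM F1 F2 : (fun B => complex.Im (F1 B * F2 B)) =
  (fun B => complex.Re (F1 B) * complex.Im (F2 B)
            + complex.Im (F1 B) * complex.Re (F2 B)).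
Proof. by apply/funext => B; rewrite ImM. Qed.

Lemma smoothC_cst (c : R[i]) : smoothC (fun=> c).
Proof. by split; exact: smooth_cst. Qed.

Lemma smoothC_val i j : smoothC (fun B : SL2 R => val B i j).
Proof.
split.
- apply: smooth_eq (smooth_real_coord (true, (i, j))) => B.
  by rewrite /real_coord /= mxE.
- apply: smooth_eq (smooth_real_coord (false, (i, j))) => B.
  by rewrite /real_coord /= mxE.
Qed.

Lemma smoothCD F1 F2 : smoothC F1 -> smoothC F2 ->
  smoothC (fun B => F1 B + F2 B).
Proof.
move=> [r1 i1] [r2 i2].
by split; rewrite ?funReD ?funImD; exact: smoothD.
Qed.

Lemma smoothCM F1 F2 : smoothC F1 -> smoothC F2 ->
  smoothC (fun B => F1 B * F2 B).
Proof.
move=> [r1 i1] [r2 i2]; split; rewrite ?funReM ?funImM; apply: smoothD.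
- exact: smoothM.
- by apply: smoothN; exact: smoothM.
- exact: smoothM.
- exact: smoothM.
Qed.

Lemma dfunC_cst A U (c : R[i]) : tangent A U -> dfunC (fun=> c) A U = 0.
Proof. by move=> tU; rewrite /dfunC !dfun_cst. Qed.

Lemma dfunC_val A U i j : tangent A U ->
  dfunC (fun B : SL2 R => val B i j) A U = U i j.
Proof.
move=> tU; rewrite /dfunC.
have := dfun_real_coord (true, (i, j)) tU.
have := dfun_real_coord (false, (i, j)) tU.
rewrite /real_coord /= !mxE.
under eq_fun do rewrite mxE.
move=> ->; under eq_fun do rewrite mxE.
by move=> ->; case: (U i j).
Qed.

Lemma dfunCD F1 F2 A U : smoothC F1 -> smoothC F2 -> tangent A U ->
  dfunC (fun B => F1 B + F2 B) A U = dfunC F1 A U + dfunC F2 A U.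
Proof.
move=> [r1 i1] [r2 i2] tU.
by rewrite /dfunC funReD funImD !dfunD.
Qed.

Lemma dfunCM F1 F2 A U : smoothC F1 -> smoothC F2 -> tangent A U ->
  dfunC (fun B => F1 B * F2 B) A U = F1 A * dfunC F2 A U + dfunC F1 A U * F2 A.
Proof.
move=> [r1 i1] [r2 i2] tU.
rewrite /dfunC funReM funImM !dfunD ?dfunN ?dfunM //;
  try exact: smoothM; last first.
  by apply: smoothN; exact: smoothM.
case: (F1 A) => a b; case: (F2 A) => c d /=.
apply/eqP; rewrite eq_complex /=; apply/andP; split; apply/eqP; ring.
Qed.

End Smooth.

(** * Matrix-valued functions and brackets *)

Lemma derive_finsum (R : realType) (E : normedModType R) (I : finType)
    (F : I -> E -> R) x v : (forall i, derivable (F i) x v) ->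
  'D_v (\sum_i F i) x = \sum_i 'D_v (F i) x.
Proof.
move=> dF; suff : derivable (\sum_i F i) x v /\
    'D_v (\sum_i F i) x = \sum_i 'D_v (F i) x by case.
elim: (index_enum I) => [|i s [ds es]].
  rewrite !big_nil; split; first exact: (derivable_cst (0 : R)).
  exact: (derive_cst (0 : R)).
rewrite !big_cons; split; first exact: derivableD (dF i) ds.
by rewrite (deriveD (dF i) ds) es.
Qed.

Section Fields.
Variable R : realType.
Local Notation M2 := 'M[R[i]]_2.
Implicit Types (A B : SL2 R) (U V : M2) (f : SL2 R -> R) (g : M2R R -> R).
Implicit Types X Y F G : SL2 R -> M2.

Definition smoothmx F := forall i j, smoothC (fun B => F B i j).

Lemma smooth_real_coord_realify F k : smoothmx F ->
  smooth (fun B => real_coord k (realify (F B))).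
Proof.
case: k => [[] [i j]] /(_ i j)[sr si]; rewrite /real_coord /=.
  by apply: smooth_eq sr => B; rewrite mxE.
by apply: smooth_eq si => B; rewrite mxE.
Qed.

Lemma real_coord_dfield F A U k :
  real_coord k (realify (dfield F A U)) =
  dfun (fun B => real_coord k (realify (F B))) A U.
Proof.
case: k => [[] [i j]]; rewrite /real_coord /= !mxE /=; congr (dfun _ A U);
  by apply/funext => B; rewrite !mxE.
Qed.

(** Expanding [X] in the real basis gives an ambient expression for [X f] near [A], so that [X f]
    can be differentiated once more. *)
Lemma local_extension_dfun f g A X (x : _ -> M2R R -> R) :
  (forall B, tangent B (X B)) -> local_extension f A g ->
  (forall k, local_extension (fun B => real_coord k (realify (X B))) A (x k)) ->
  local_extension (fun B => dfun f B (X B)) A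
    (\sum_k x k * 'D_(real_basis R k) g).
Proof.
move=> tX [P [oP PA Cg gf]] ex.
apply: (@local_extension_eq _ (fun B => \sum_k real_coord k (realify (X B)) *
    'D_(real_basis R k) g (realify (val B))) _ A _ P) => //.
  (* The same [g] extends [f] at every group point of [P], not only at [A]. *)
  move=> B PB; rewrite (@dfunE _ _ _ _ g); [|by exists P|exact: tX].
  rewrite [in RHS](real_coord_sum (realify (X B))).
  rewrite derive_dir_sum; last exact: Coo_differentiable Cg PB.
  apply: eq_bigr => k _; rewrite derive_dirZ //.
  exact: Coo_differentiable Cg PB.
apply: local_extension_sum => k; apply: local_extensionM => //.
by exists P; split=> //; exact: Coo_derive.
Qed.

Lemma smooth_dfun f X : (forall B, tangent B (X B)) -> smoothmx X -> smooth f ->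
  smooth (fun B => dfun f B (X B)).
Proof.
move=> tX sX sf A; have [g eg] := sf A.
have /choice[x ex] : forall k, exists x,
    local_extension (fun B => real_coord k (realify (X B))) A x.
  by move=> k; exact: smooth_real_coord_realify.
by exists (\sum_k x k * 'D_(real_basis R k) g); exact: local_extension_dfun.
Qed.

(** The bracket is defined through matrix entries; here it acts as a commutator on every smooth
    function. The Hessian parts of [X (Y f)] and [Y (X f)] agree, and the first-order parts differ
    by the derivative along [dY(X) - dX(Y)]. *)
Lemma dfun_bracket f X Y A : (forall B, tangent B (X B)) ->
  (forall B, tangent B (Y B)) -> smoothmx X -> smoothmx Y -> smooth f ->
  tangent A (bracket X Y A) ->
  dfun f A (bracket X Y A) = dfun (fun B => dfun f B (Y B)) A (X A)
                           - dfun (fun B => dfun f B (X B)) A (Y A).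
Proof.
move=> tX tY sX sY sf tXY; have [g eg] := sf A.
have [Q [oQ QA Cg gf]] := eg.
have Cd v : Coo Q ('D_v g) by exact: Coo_derive.
have /choice[x ex] : forall k, exists x,
    local_extension (fun B => real_coord k (realify (X B))) A x.
  by move=> k; exact: smooth_real_coord_realify.
have /choice[y ey] : forall k, exists y,
    local_extension (fun B => real_coord k (realify (Y B))) A y.
  by move=> k; exact: smooth_real_coord_realify.
pose D k := 'D_(real_basis R k) g.
(* The product rule splits [W (Z f)] into a Hessian part and a part of first order in [f]. It is
   stated for general [W] and [Z] to serve both orders. *)
have second W Z (w z : _ -> M2R R -> R) : (forall B, tangent B (W B)) ->
    (forall B, tangent B (Z B)) ->
    (forall k,
      local_extension (fun B => real_coord k (realify (W B))) A (w k)) ->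
    (forall k,
      local_extension (fun B => real_coord k (realify (Z B))) A (z k)) ->
    dfun (fun B => dfun f B (Z B)) A (W A) =
    \sum_k \sum_l real_coord k (realify (Z A)) * real_coord l (realify (W A))
                  * 'D_(real_basis R l) (D k) (realify (val A))
    + \sum_k real_coord k (realify (dfield Z A (W A))) * D k (realify (val A)).
  move=> tW tZ ew ez.
  rewrite (dfunE (local_extension_dfun tZ eg ez) (tW A)).
  have dz k : derivable (z k) (realify (val A)) (realify (W A)).
    exact: local_extension_derivable (ez k).
  have dD k : derivable (D k) (realify (val A)) (realify (W A)).
    exact: Coo_derivable (Cd _) QA.
  rewrite derive_finsum; last by move=> k; exact: (derivableM (dz k) (dD k)).
  rewrite -big_split /=; apply: eq_bigr => k _.
  rewrite (deriveM (dz k) (dD k)) (local_extension_at (ez k)) real_coord_dfield.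
  rewrite (dfunE (ez k) (tW A)) [X in _ = _ + X]mulrC; congr (_ + _).
  rewrite [in LHS](real_coord_sum (realify (W A))).
  rewrite derive_dir_sum; last exact: Coo_differentiable (Cd _) QA.
  rewrite [LHS]mulr_sumr; apply: eq_bigr => l _.
  rewrite derive_dirZ ?mulrA //; exact: Coo_differentiable (Cd _) QA.
rewrite (second X Y x y) // (second Y X y x) //.
(* Exchanging the sums aligns the two Hessian parts, which then cancel term by term by symmetry of
   second derivatives. *)
rewrite [X in _ - (X + _)]exchange_big /= opprD addrACA.
rewrite -[X in _ = X + _]sumrB big1 ?add0r; last first.
  move=> k _; rewrite -sumrB big1 // => l _.
  rewrite (Coo_derive_comm _ _ oQ QA Cg) [X in X * _]mulrC; exact: subrr.
rewrite (dfunE eg tXY) (real_coord_sum (realify (bracket X Y A))).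
have dg : differentiable g (realify (val A)) by exact: Coo_differentiable Cg QA.
rewrite derive_dir_sum // -sumrB; apply: eq_bigr => k _.
by rewrite derive_dirZ // -mulrBl /bracket realifyD realifyN linearB.
Qed.

Lemma smoothmx_dfield F X : (forall B, tangent B (X B)) -> smoothmx X ->
  smoothmx F -> smoothmx (fun B => dfield F B (X B)).
Proof.
move=> tX sX sF i j; have [sr si] := sF i j; split.
- by apply: smooth_eq (smooth_dfun tX sX sr) => B; rewrite mxE.
- by apply: smooth_eq (smooth_dfun tX sX si) => B; rewrite mxE.
Qed.

Lemma smoothmx_cst (M : M2) : smoothmx (fun=> M).
Proof. by move=> i j; exact: smoothC_cst. Qed.

Lemma smoothmx_val : smoothmx (fun B : SL2 R => val B).
Proof. by move=> i j; exact: smoothC_val. Qed.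

Lemma smoothmxD F G : smoothmx F -> smoothmx G -> smoothmx (fun B => F B + G B).
Proof.
move=> sF sG i j.
rewrite (_ : (fun B => _) = fun B => F B i j + G B i j); first exact: smoothCD.
by apply/funext => B; rewrite mxE.
Qed.

Lemma smoothmxZ (c : R[i]) F : smoothmx F -> smoothmx (fun B => c *: F B).
Proof.
move=> sF i j.
rewrite (_ : (fun B => _) = fun B => c * F B i j).
  by apply: smoothCM => //; exact: smoothC_cst.
by apply/funext => B; rewrite mxE.
Qed.

Lemma smoothmxM F G : smoothmx F -> smoothmx G ->
  smoothmx (fun B => F B *m G B).
Proof.
move=> sF sG i j.
rewrite (_ : (fun B => _) = fun B => F B i 0 * G B 0 j + F B i 1 * G B 1 j).
  by apply: smoothCD; exact: smoothCM.
by apply/funext => B; rewrite mulmx2E.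
Qed.

(** Cayley-Hamilton with determinant one. The inverse thus becomes polynomial in the entries, hence
    smooth. *)
Lemma invmx_SL2E B :
  invmx (val B) = (\tr (val B))%:M + (-1) *: val B.
Proof.
have e : \det (val B) = 1 by exact/eqP/(valP B).
apply: (can_inj (mulmxK (SL2_unitmx B))); rewrite mulVmx ?SL2_unitmx //.
move: e; rewrite det2E trmx2E; set b := val B => e.
by apply: mx2P; rewrite mulmx2E !mxE /= ?mulr1n ?mulr0n;
  [rewrite -[LHS]e|..|rewrite -[LHS]e]; ring.
Qed.

Lemma smoothmx_inv : smoothmx (fun B : SL2 R => invmx (val B)).
Proof.
rewrite (_ : (fun B => _) =
  (fun B : SL2 R => (\tr (val B))%:M + (-1) *: val B)).
  apply: smoothmxD; last by apply: smoothmxZ; exact: smoothmx_val.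
  move=> i j; rewrite (_ : (fun B => _) =
      (fun B : SL2 R => (val B 0 0 + val B 1 1) * (i == j)%:R)).
    apply: smoothCM; last exact: smoothC_cst.
    by apply: smoothCD; exact: smoothC_val.
  by apply/funext => B; rewrite mxE trmx2E mulr_natr.
by apply/funext => B; exact: invmx_SL2E.
Qed.

Lemma dfield_cst (M : M2) A U : tangent A U -> dfield (fun=> M) A U = 0.
Proof. by move=> tU; apply/matrixP => i j; rewrite !mxE dfunC_cst. Qed.

Lemma dfield_val A U : tangent A U -> dfield (fun B : SL2 R => val B) A U = U.
Proof. by move=> tU; apply/matrixP => i j; rewrite !mxE dfunC_val. Qed.

Lemma dfieldD F G A U : smoothmx F -> smoothmx G -> tangent A U ->
  dfield (fun B => F B + G B) A U = dfield F A U + dfield G A U.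
Proof.
move=> sF sG tU; apply/matrixP => i j; rewrite !mxE -dfunCD //.
by congr (dfunC _ A U); apply/funext => B; rewrite mxE.
Qed.

Lemma dfieldZ (c : R[i]) F A U : smoothmx F -> tangent A U ->
  dfield (fun B => c *: F B) A U = c *: dfield F A U.
Proof.
move=> sF tU; apply/matrixP => i j; rewrite !mxE.
rewrite (_ : (fun B => _) = fun B => c * F B i j); last first.
  by apply/funext => B; rewrite mxE.
by rewrite dfunCM ?dfunC_cst ?mul0r ?addr0 //; exact: smoothC_cst.
Qed.

Lemma dfieldM F G A U : smoothmx F -> smoothmx G -> tangent A U ->
  dfield (fun B => F B *m G B) A U = F A *m dfield G A U + dfield F A U *m G A.
Proof.
move=> sF sG tU; apply/matrixP => i j.
rewrite mxE [RHS]mxE !mulmx2E !mxE.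
rewrite (_ : (fun B => _) = fun B => F B i 0 * G B 0 j + F B i 1 * G B 1 j).
  by rewrite dfunCD ?dfunCM //; [ring|exact: smoothCM|exact: smoothCM].
by apply/funext => B; rewrite mulmx2E.
Qed.

(** Obtained by differentiating [B *m invmx B = 1%:M] along the group. *)
Lemma dfield_inv A U : tangent A U ->
  dfield (fun B => invmx (val B)) A U = - (invmx (val A) *m U *m invmx (val A)).
Proof.
move=> tU; have uA := SL2_unitmx A.
have := dfieldM smoothmx_val smoothmx_inv tU.
rewrite (_ : (fun B => _) = fun=> 1%:M); last first.
  by apply/funext => B; rewrite mulmxV // SL2_unitmx.
rewrite dfield_cst // dfield_val // => /esym/eqP; rewrite addr_eq0 => /eqP e.
by rewrite -[LHS](mulKmx uA) e mulmxN mulmxA.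
Qed.

Lemma smoothC_mxtrace F : smoothmx F -> smoothC (fun B => \tr (F B)).
Proof.
move=> sF; rewrite (_ : (fun B => _) = fun B => F B 0 0 + F B 1 1).
  exact: smoothCD.
by apply/funext => B; rewrite trmx2E.
Qed.

Lemma dfunC_mxtrace F A U : smoothmx F -> tangent A U ->
  dfunC (fun B => \tr (F B)) A U = \tr (dfield F A U).
Proof.
move=> sF tU; rewrite trmx2E !mxE -dfunCD //.
by congr (dfunC _ A U); apply/funext => B; rewrite trmx2E.
Qed.

End Fields.

(** * The Levi-Civita connection *)

(** Turns the equality of two metric product rules into skewness of the difference of the
    connections. *)
Lemma subr_eq_opp (V : zmodType) (a b c d : V) :
  a + b = c + d -> a - c = - (b - d).
Proof.
move=> e; apply/eqP; rewrite -addr_eq0 addrACA -opprD e subrr; exact/eqP.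
Qed.

(** Turns the vanishing of torsion into symmetry of the difference of the connections; [m] is the
    symmetric correction term of the closed form. *)
Lemma subr_eq_sub (V : zmodType) (a b c d m : V) :
  a - b = c - d -> c - (a - m) = d - (b - m).
Proof.
move=> e; rewrite !opprB !addrA ![_ + m]addrC -!addrA; congr (_ + _).
by apply/eqP; rewrite subr_eq addrAC -addrA e addrC subrK.
Qed.

(** Alternating the two transpositions six times returns to the original order with three sign
    changes, so the value equals its own opposite. *)
Lemma symmetric_skew_eq0 (K : numDomainType) (T : Type) (P : T -> Prop)
    (s : T -> T -> T -> K) :
  (forall x y z, P x -> P y -> P z -> s x y z = s y x z) ->
  (forall x y z, P x -> P y -> P z -> s x y z = - s x z y) ->
  forall x y z, P x -> P y -> P z -> s x y z = 0.
Proof.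
move=> sym skew x y z Px Py Pz.
have : s x y z = - s x y z.
  rewrite {1}skew // (sym x z) // (skew z) // opprK (sym z) //.
  by rewrite (skew y) // (sym y).
move=> /eqP; rewrite -addr_eq0 -mulr2n -mulr_natr mulf_eq0 pnatr_eq0 orbF.
by move=> /eqP.
Qed.

(** * Trace identities and the algebra of the curvature *)

Section MatrixAlgebra.
Variable K : numFieldType.

(** Under the trace the symmetrized correction of the connection may be replaced by the one-sided
    product that appears when a left trivialization is differentiated. *)
Lemma mxtrace_sym_half n (p q u : 'M[K]_n) :
  \tr (u - 2^-1 *: (p *m q + q *m p)) = \tr (u - p *m q).
Proof.
rewrite !raddfB /= linearZ /= mxtraceD (mxtrace_mulC q p); congr (_ - _).
by field.
Qed.

(** Here [p], [q], [r] are left trivializations of three fields, and the left-hand side is the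
    derivative of [\tr (q *m r)] along the first. Cyclicity of the trace matches the cubic terms. *)
Lemma mxtrace_product_rule n (p q r u w l m : 'M[K]_n) :
  l = u - 2^-1 *: (p *m q + q *m p) -> m = w - 2^-1 *: (p *m r + r *m p) ->
  \tr (q *m (w - p *m r) + (u - p *m q) *m r) = \tr (l *m r) + \tr (q *m m).
Proof.
move=> -> ->.
have c : \tr (q *m (r *m p)) = \tr (p *m q *m r).
  by rewrite mulmxA mxtrace_mulC mulmxA.
rewrite !(mulmxBl, mulmxBr) -scalemxAl -scalemxAr !(mulmxDl, mulmxDr).
rewrite !mxtraceD !raddfN /= !mxtraceZ !mxtraceD c -(mulmxA q p r).
by field.
Qed.

Lemma mxtrace_form_nondegenerate (u : 'M[K]_2) : \tr u = 0 ->
  (forall v : 'M[K]_2, \tr v = 0 -> \tr (u *m v) = 0) -> u = 0.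
Proof.
rewrite trmx2E => t00 tr0.
(* Testing against the standard basis of sl(2) isolates the entries of [u]. *)
have := tr0 (delta_mx 0 1); have := tr0 (delta_mx 1 0).
have := tr0 (delta_mx 0 0 - delta_mx 1 1).
rewrite !trmx2E !mulmx2E !mxE /=.
rewrite !(subr0, sub0r, mulr0, mulr1, mulrN1, add0r, addr0, oppr0).
move=> /(_ (subrr _)) e1 /(_ erefl) e2 /(_ erefl) e3.
have e4 : u 0 0 = 0.
  have : 2 * u 0 0 = 0.
    transitivity ((u 0 0 + u 1 1) + (u 0 0 - u 1 1)); first by ring.
    by rewrite t00 e1 addr0.
  by move/eqP; rewrite mulf_eq0 pnatr_eq0 /= => /eqP.
by apply: mx2P; rewrite mxE // -t00 e4 add0r.
Qed.

Lemma mxtrace_form0 n (u v : 'M[K]_n) : 2^-1 * \tr (u *m v) = 0 ->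
  \tr (u *m v) = 0.
Proof. by move/eqP; rewrite mulf_eq0 invr_eq0 pnatr_eq0 /= => /eqP. Qed.

(* [b], [x], [y], [z] stand for the inverse of the base point and the values of
   three fields, [dxy] for the derivative of the second field along the first,
   and so on; [d2xyz] are second derivatives, all of which cancel. *)
Lemma curvature_algebra n (b x y z dxy dyx dxz dyz d2xyz d2yxz : 'M[K]_n) :
  (d2xyz + (- 2^-1) *:
    ((y *m b *m dxz + (y *m - (b *m x *m b) + dxy *m b) *m z)
     + (z *m b *m dxy + (z *m - (b *m x *m b) + dxz *m b) *m y))
   - 2^-1 *: (x *m b *m (dyz - 2^-1 *: (y *m b *m z + z *m b *m y))
              + (dyz - 2^-1 *: (y *m b *m z + z *m b *m y)) *m b *m x))
  - (d2yxz + (- 2^-1) *: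
    ((x *m b *m dyz + (x *m - (b *m y *m b) + dyx *m b) *m z)
     + (z *m b *m dyx + (z *m - (b *m y *m b) + dyz *m b) *m x))
   - 2^-1 *: (y *m b *m (dxz - 2^-1 *: (x *m b *m z + z *m b *m x))
              + (dxz - 2^-1 *: (x *m b *m z + z *m b *m x)) *m b *m y))
  - ((d2xyz - d2yxz)
     - 2^-1 *: ((dxy - dyx) *m b *m z + z *m b *m (dxy - dyx)))
  = - 4^-1 *: (x *m b *m y *m b *m z - y *m b *m x *m b *m z
               - z *m b *m x *m b *m y + z *m b *m y *m b *m x).
Proof.
rewrite !(mulmxDl, mulmxDr, mulmxBl, mulmxBr, mulNmx, mulmxN,
  scalerDr, scalerBr).
(* The words free of derivatives are the six orderings of [x], [y], [z] separated by [b]; the two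
   with [z] in the middle cancel. *)
rewrite -!scalemxAl -!scalemxAr -?scalemxAl !mulmxA.
set t1 := x *m b *m y *m b *m z; set t2 := y *m b *m x *m b *m z.
set t3 := z *m b *m x *m b *m y; set t4 := z *m b *m y *m b *m x.
set t5 := x *m b *m z *m b *m y; set t6 := y *m b *m z *m b *m x.
(* The identity is now linear in the words. Entries are taken through the linear operations only, so
   that each matrix product remains an atom for [field]. *)
have opE (M : 'M[K]_n) i j : (- M) i j = - M i j by rewrite mxE.
have adE (M N : 'M[K]_n) i j : (M + N) i j = M i j + N i j by rewrite mxE.
have scE c (M : 'M[K]_n) i j : (c *: M) i j = c * M i j by rewrite mxE.
apply/matrixP => i j; rewrite !(opE, adE, scE).
by field.
Qed.

(** With [g] the base point and [b] its inverse, this recognizes the outcome of [curvature_algebra]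
    as the left translate of a double Lie bracket. *)
Lemma lie_translate n (c : K) (g b x y z : 'M[K]_n) :
  (forall M : 'M[K]_n, g *m (b *m M) = M) ->
  g *m (c *: (((b *m x) *m (b *m y) - (b *m y) *m (b *m x)) *m (b *m z)
             - (b *m z) *m ((b *m x) *m (b *m y) - (b *m y) *m (b *m x)))) =
  c *: (x *m b *m y *m b *m z - y *m b *m x *m b *m z
        - z *m b *m x *m b *m y + z *m b *m y *m b *m x).
Proof.
move=> gK; rewrite -scalemxAr mulmxBl !mulmxBr -!mulmxA !gK opprB.
by rewrite addrA -!addrA [X in _ + (_ + X)]addrC.
Qed.

End MatrixAlgebra.

(** * The closed form of the connection *)

Section MatrixField.
Variables (R : realType) (Q : SLquotient).
Local Notation M2 := 'M[R[i]]_2.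
Implicit Types (A B : SL2 R) (U V W : M2) (X Y Z : SL2 R -> M2).

Lemma vector_field_tangent X A : vector_field Q X -> tangent A (X A).
Proof. by case. Qed.

Lemma vector_field_smooth X : vector_field Q X -> smoothmx X.
Proof. by case. Qed.

(** Any tangent vector is the value of a global field, so identities between fields can be tested on
    single vectors. *)
Lemma vector_field_translate A V : tangent A V ->
  vector_field Q (fun B => val B *m (invmx (val A) *m V)).
Proof.
move=> tV; split.
- by move=> B; rewrite /tangent /= mulKmx ?SL2_unitmx.
- by apply: smoothmxM; [exact: smoothmx_val|exact: smoothmx_cst].
- by case: Q => // B B' /= ->; rewrite mulNmx.
Qed.

Lemma tangentB A U V : tangent A U -> tangent A V -> tangent A (U - V).
Proof.
by rewrite /tangent /sl2 /= mulmxBr raddfB /= => -> ->; rewrite subrr.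
Qed.

Lemma vector_fieldB X Y : vector_field Q X -> vector_field Q Y ->
  vector_field Q (fun B => X B - Y B).
Proof.
move=> [tX sX dX] [tY sY dY]; split.
- by move=> B; exact: tangentB.
- suff : smoothmx (fun B => X B - Y B) by [].
  have -> : (fun B => X B - Y B) = fun B => X B + (-1) *: Y B.
    by apply/funext => B; rewrite scaleN1r.
  by apply: smoothmxD => //; exact: smoothmxZ.
- by move=> B B' e; rewrite (dX _ _ e) (dY _ _ e) opprB opprK addrC.
Qed.

Lemma metricE A U V :
  metric A U V = 2^-1 * \tr (invmx (val A) *m U *m (invmx (val A) *m V)).
Proof. by rewrite /metric /kill mulrA; congr (_ * _); field. Qed.

Lemma metricC A U V : metric A U V = metric A V U.
Proof. by rewrite !metricE mxtrace_mulC. Qed.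

Lemma metricBl A U V W : metric A (U - V) W = metric A U W - metric A V W.
Proof. by rewrite !metricE mulmxBr mulmxBl raddfB /= mulrBr. Qed.

Lemma metricBr A U V W : metric A W (U - V) = metric A W U - metric A W V.
Proof. by rewrite ![metric A W _]metricC metricBl. Qed.

Lemma metric_nondegenerate A U : tangent A U ->
  (forall V, tangent A V -> metric A U V = 0) -> U = 0.
Proof.
move=> tU U0; have uA := SL2_unitmx A.
suff u0 : invmx (val A) *m U = 0 by rewrite -[U](mulKVmx uA) u0 mulmx0.
apply: mxtrace_form_nondegenerate tU _ => v tv; apply: mxtrace_form0.
rewrite -[in LHS](mulKmx uA v) -metricE; apply: U0.
by rewrite /tangent /= mulKmx.
Qed.

(* [dY(X)] is the derivative of the matrix entries of [Y] in the ambient space;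
   the correction is what makes it tangent and metric. *)
Definition lc_connection X Y A : M2 := dfield Y A (X A) - 2^-1 *:
  (X A *m invmx (val A) *m Y A + Y A *m invmx (val A) *m X A).

Lemma mulmx_invmx_lc X Y A : invmx (val A) *m lc_connection X Y A =
  invmx (val A) *m dfield Y A (X A) - 2^-1 *:
    ((invmx (val A) *m X A) *m (invmx (val A) *m Y A)
     + (invmx (val A) *m Y A) *m (invmx (val A) *m X A)).
Proof. by rewrite /lc_connection mulmxBr -scalemxAr mulmxDr !mulmxA. Qed.

Lemma dfield_left_trivialized A U Y : smoothmx Y -> tangent A U ->
  dfield (fun B => invmx (val B) *m Y B) A U =
  invmx (val A) *m dfield Y A U
  - (invmx (val A) *m U) *m (invmx (val A) *m Y A).
Proof.
move=> sY tU; rewrite dfieldM //; last exact: smoothmx_inv.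
by rewrite dfield_inv // mulNmx !mulmxA.
Qed.

(** The trace that has to vanish is the derivative along [X] of the trace of the left trivialization
    of [Y], a function identically zero on the group. *)
Lemma lc_tangent X Y A : vector_field Q X -> vector_field Q Y ->
  tangent A (lc_connection X Y A).
Proof.
move=> vX vY; have tX := vector_field_tangent A vX.
have sY := vector_field_smooth vY.
have siY : smoothmx (fun B => invmx (val B) *m Y B).
  by apply: smoothmxM => //; exact: smoothmx_inv.
rewrite /tangent /sl2 /= mulmx_invmx_lc mxtrace_sym_half.
rewrite -dfield_left_trivialized // -dfunC_mxtrace //.
rewrite (_ : (fun B => _) = fun=> 0); first exact: dfunC_cst.
by apply/funext => B; exact: (vector_field_tangent B vY).
Qed.

Lemma lc_metric X Y Z A : vector_field Q X -> vector_field Q Y ->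
  vector_field Q Z ->
  dfunC (fun B => metric B (Y B) (Z B)) A (X A) =
  metric A (lc_connection X Y A) (Z A) + metric A (Y A) (lc_connection X Z A).
Proof.
move=> vX vY vZ; have tX := vector_field_tangent A vX.
have sY := vector_field_smooth vY; have sZ := vector_field_smooth vZ.
have siY : smoothmx (fun B => invmx (val B) *m Y B).
  by apply: smoothmxM => //; exact: smoothmx_inv.
have siZ : smoothmx (fun B => invmx (val B) *m Z B).
  by apply: smoothmxM => //; exact: smoothmx_inv.
have -> : (fun B => metric B (Y B) (Z B)) = (fun B => 2^-1 *
    \tr (invmx (val B) *m Y B *m (invmx (val B) *m Z B))).
  by apply/funext => B; rewrite metricE.
rewrite dfunCM //; [|exact: smoothC_cst|by apply/smoothC_mxtrace/smoothmxM].
rewrite dfunC_cst // mul0r addr0 dfunC_mxtrace //; last exact: smoothmxM.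
rewrite dfieldM // !dfield_left_trivialized // !metricE -mulrDr; congr (_ * _).
exact: (mxtrace_product_rule (mulmx_invmx_lc X Y A) (mulmx_invmx_lc X Z A)).
Qed.

End MatrixField.

(** * Uniqueness of the Levi-Civita connection *)

Section Uniqueness.
Variables (R : realType) (Q : SLquotient).
Variable D : (SL2 R -> 'M[R[i]]_2) -> (SL2 R -> 'M[R[i]]_2) ->
             SL2 R -> 'M[R[i]]_2.
Hypothesis hD : levi_civita Q D.
Implicit Types (A : SL2 R) (X Y Z : SL2 R -> 'M[R[i]]_2).

Lemma levi_civitaE X Y : vector_field Q X -> vector_field Q Y ->
  D X Y = lc_connection X Y.
Proof.
move=> vX vY; apply/funext => A; apply/eqP; rewrite -subr_eq0; apply/eqP.
have [[vD _ _ _ _] mD tD] := hD.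
pose S X Y := D X Y A - lc_connection X Y A.
have tS : tangent A (S X Y).
  by apply: tangentB; [exact: vector_field_tangent (vD _ _ vX vY)|
                       exact: lc_tangent vX vY].
apply: metric_nondegenerate tS _ => V tV.
(* The test vector is rewritten as the value at [A] of its left-invariant extension, since metric
   compatibility speaks of fields. *)
have ZA : val A *m (invmx (val A) *m V) = V by rewrite mulKVmx // SL2_unitmx.
rewrite -ZA.
have s0 := @symmetric_skew_eq0 R[i] _ (vector_field Q)
  (fun X Y Z => metric A (S X Y) (Z A)).
apply: s0 vX vY (vector_field_translate Q tV).
(* Symmetry comes from the torsion condition, the correction term of the closed form being
   symmetric. *)
- move=> X' Y' Z' vX' vY' _; apply: (congr1 (fun U => metric A U (Z' A))).
  apply: etrans (subr_eq_sub _ (tD X' Y' vX' vY' A)) _.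
  exact: (congr1 (fun M => D Y' X' A - (dfield X' A (Y' A) - 2^-1 *: M))
    (addrC _ _)).
(* Skewness comes from comparing the two metric product rules. *)
- move=> X' Y' Z' vX' vY' vZ'.
  have e := etrans (esym (mD _ _ _ vX' vY' vZ' A)) (lc_metric A vX' vY' vZ').
  apply: etrans (metricBl _ _ _ _) _; apply: etrans (subr_eq_opp e) _.
  apply: (congr1 -%R); exact: etrans (esym (metricBr _ _ _ _)) (metricC _ _ _).
Qed.

End Uniqueness.

(** * Curvature *)

Section Curvature.
Variables (R : realType) (Q : SLquotient).
Variable D : (SL2 R -> 'M[R[i]]_2) -> (SL2 R -> 'M[R[i]]_2) ->
             SL2 R -> 'M[R[i]]_2.
Hypothesis hD : levi_civita Q D.
Implicit Types (A : SL2 R) (X Y Z : SL2 R -> 'M[R[i]]_2).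

(** Tangency and smoothness of the bracket are read off from [D X Y - D Y X], which equals it by the
    torsion condition. *)
Lemma bracket_vector_field X Y : vector_field Q X -> vector_field Q Y ->
  vector_field Q (bracket X Y).
Proof.
have [[vD _ _ _ _] _ tD] := hD => vX vY.
have -> : bracket X Y = fun A => D X Y A - D Y X A by apply/funext; exact: tD.
by apply: vector_fieldB; exact: vD.
Qed.

Lemma dfunC_bracket (f : SL2 R -> R[i]) X Y A : vector_field Q X ->
  vector_field Q Y -> smoothC f ->
  dfunC f A (bracket X Y A) = dfunC (fun B => dfunC f B (Y B)) A (X A)
                            - dfunC (fun B => dfunC f B (X B)) A (Y A).
Proof.
move=> vX vY [sr si].
have tX B := vector_field_tangent B vX; have tY B := vector_field_tangent B vY.
have sX := vector_field_smooth vX; have sY := vector_field_smooth vY.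
have tXY := vector_field_tangent A (bracket_vector_field vX vY).
rewrite {1}/dfunC (dfun_bracket tX tY sX sY sr tXY).
by rewrite (dfun_bracket tX tY sX sY si tXY).
Qed.

Lemma dfield_bracket X Y Z A : vector_field Q X -> vector_field Q Y ->
  vector_field Q Z ->
  dfield Z A (bracket X Y A) = dfield (fun B => dfield Z B (Y B)) A (X A)
                             - dfield (fun B => dfield Z B (X B)) A (Y A).
Proof.
move=> vX vY vZ; apply/matrixP => i j.
have e W V : dfield (fun B => dfield Z B (W B)) A V i j =
    dfunC (fun B => dfunC (fun B => Z B i j) B (W B)) A V.
  by rewrite mxE; congr (dfunC _ A V); apply/funext => B; rewrite mxE.
rewrite mxE (dfunC_bracket A vX vY (vector_field_smooth vZ i j)).
have sE (M N : 'M[R[i]]_2) : (M - N) i j = M i j - N i j by rewrite !mxE.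
exact: esym (etrans (sE _ _) (f_equal2 (fun a b => a - b) (e _ _) (e _ _))).
Qed.

Lemma dfield_lc X Y Z A : vector_field Q X -> vector_field Q Y ->
  vector_field Q Z -> let a := invmx (val A) in
  dfield (lc_connection Y Z) A (X A) =
  dfield (fun B => dfield Z B (Y B)) A (X A) + (- 2^-1) *:
    ((Y A *m a *m dfield Z A (X A)
      + (Y A *m - (a *m X A *m a) + dfield Y A (X A) *m a) *m Z A)
     + (Z A *m a *m dfield Y A (X A)
      + (Z A *m - (a *m X A *m a) + dfield Z A (X A) *m a) *m Y A)).
Proof.
move=> vX vY vZ a; have tX := vector_field_tangent A vX.
have tY B := vector_field_tangent B vY.
have sY := vector_field_smooth vY; have sZ := vector_field_smooth vZ.
have sI := @smoothmx_inv R.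
have sYI := smoothmxM sY sI; have sZI := smoothmxM sZ sI.
have sYZ := smoothmxM sYI sZ; have sZY := smoothmxM sZI sY.
have sdZ := smoothmx_dfield tY sY sZ.
have -> : lc_connection Y Z = (fun B => dfield Z B (Y B) + (- 2^-1) *:
    (Y B *m invmx (val B) *m Z B + Z B *m invmx (val B) *m Y B)).
  by apply/funext => B; rewrite scaleNr.
have sS := smoothmxD sYZ sZY.
rewrite (dfieldD sdZ (smoothmxZ (- 2^-1) sS) tX) (dfieldZ (- 2^-1) sS tX).
rewrite (dfieldD sYZ sZY tX) (dfieldM sYI sZ tX) (dfieldM sZI sY tX).
by rewrite (dfieldM sY sI tX) (dfieldM sZ sI tX) dfield_inv.
Qed.

Lemma curvatureE X Y Z A : vector_field Q X -> vector_field Q Y ->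
  vector_field Q Z -> curvature D X Y Z A =
  val A *m (- 4^-1 *: lie (lie (invmx (val A) *m X A) (invmx (val A) *m Y A))
                          (invmx (val A) *m Z A)).
Proof.
move=> vX vY vZ; have [[vD _ _ _ _] _ _] := hD.
have vXY := bracket_vector_field vX vY.
have eXZ := levi_civitaE hD vX vZ; have eYZ := levi_civitaE hD vY vZ.
(* The inner derivatives are themselves fields, so the closed form applies to the outer ones too. *)
have vXZ : vector_field Q (lc_connection X Z) by rewrite -eXZ; exact: vD.
have vYZ : vector_field Q (lc_connection Y Z) by rewrite -eYZ; exact: vD.
rewrite /curvature eXZ eYZ (levi_civitaE hD vX vYZ) (levi_civitaE hD vY vXZ).
rewrite (levi_civitaE hD vXY vZ) {1}/lc_connection (dfield_lc A vX vY vZ).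
rewrite {3}/lc_connection (dfield_lc A vY vX vZ).
rewrite {5}/lc_connection (dfield_bracket A vX vY vZ).
have gK (M : 'M[R[i]]_2) : val A *m (invmx (val A) *m M) = M.
  by rewrite mulKVmx // SL2_unitmx.
exact: etrans (curvature_algebra _ _ _ _ _ _ _ _ _ _)
  (esym (lie_translate _ _ _ _ gK)).
Qed.

End Curvature.

(** * Gram determinants and identities in sl(2) *)

(** If the determinant vanished, [b w w *: v - b v w *: w] would be orthogonal to the plane, hence
    zero. Independence then gives [b w w = b v w = 0], so [w] is orthogonal to the plane as well and
    must vanish, a contradiction. *)
Lemma gram_neq0 (K : fieldType) (E : vectType K) (b : E -> E -> K)
    (P : {vspace E}) (v w : E) :
  (forall x y, b x y = b y x) ->
  (forall (c : K) x y z, b (c *: x + y) z = c * b x z + b y z) ->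
  \dim P = 2%N -> <<[:: v; w]>>%VS = P ->
  (forall x, x \in P -> (forall y, y \in P -> b x y = 0) -> x = 0) ->
  b v v * b w w - b v w ^+ 2 != 0.
Proof.
move=> bC bL dP sP nd.
have fr : free [:: v; w] by rewrite /free /= sP dP.
have vP : v \in P by rewrite -sP memv_span ?mem_head.
have wP : w \in P by rewrite -sP memv_span // !inE eqxx orbT.
have b0 z : b 0 z = 0.
  by have := bL (-1) z z z; rewrite scaleN1r addNr mulN1r addNr.
have bZ c x z : b (c *: x) z = c * b x z.
  by have := bL c x 0 z; rewrite !addr0 b0 addr0.
have orth x : x \in P -> b x v = 0 -> b x w = 0 -> x = 0.
  move=> xP xv xw; apply: nd xP _ => y.
  rewrite -sP span_cons span_seq1.
  move=> /memv_addP[_ /vlineP[c ->]] [_ /vlineP[d ->]] ->.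
  by rewrite bC bL bZ (bC v) (bC w) xv xw !mulr0 addr0.
have indep (c d : K) : c *: v + d *: w = 0 -> c = 0 /\ d = 0.
  move=> e; have /freeP f2 := fr.
  have := f2 (fun i : 'I_2 => if i == 0 then c else d).
  rewrite big_ord_recl big_ord1 /= => /(_ e) h.
  by have := h 0; have := h 1; rewrite /= => -> ->.
apply/negP => /eqP g0.
have [ww vw] : b w w = 0 /\ - b v w = 0.
  apply: indep; apply: orth.
  - by rewrite memvD // memvZ.
  - by rewrite bL bZ (bC w v) -[RHS]g0; ring.
  - by rewrite bL bZ; ring.
have w0 : w = 0.
  by apply: orth => //; rewrite bC; apply/eqP; rewrite -oppr_eq0 vw.
have [] := indep 0 1; first by rewrite w0 scale0r scaler0 addr0.
by move=> _ /eqP; rewrite oner_eq0.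
Qed.

Lemma half_sub (K : numFieldType) n (a b : 'M[K]_n) :
  a - 2^-1 *: (a + b) = 2^-1 *: (a - b).
Proof.
by apply/matrixP => i j; rewrite !mxE; field.
Qed.

Section Sl2Algebra.
Variable K : numFieldType.
Implicit Types u v w : 'M[K]_2.

Lemma trmx2_eq0 u : \tr u = 0 -> u 1 1 = - u 0 0.
Proof. by rewrite trmx2E => t; apply/eqP; rewrite -addr_eq0 addrC t. Qed.

(** The bracket is, up to a factor, a complex cross product, and this is its Lagrange identity. It
    is checked as a polynomial identity once the trace has eliminated one entry of each matrix. *)
Lemma sl2_lie_sqnorm u v : \tr u = 0 -> \tr v = 0 ->
  2^-1 * \tr ((u *m v - v *m u) *m (u *m v - v *m u)) =
  - 4 * (2^-1 * \tr (u *m u)) * (2^-1 * \tr (v *m v))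
  + 4 * (2^-1 * \tr (u *m v)) ^+ 2.
Proof.
have opE (M : 'M[K]_2) i j : (- M) i j = - M i j by rewrite mxE.
have adE (M N : 'M[K]_2) i j : (M + N) i j = M i j + N i j by rewrite mxE.
move=> /trmx2_eq0 u1 /trmx2_eq0 v1.
by rewrite !trmx2E !mulmx2E !adE !opE !mulmx2E u1 v1; field.
Qed.

(** The numerator of the sectional curvature. By ad-invariance of the trace form it is a quarter of
    the square norm of the bracket of [v] and [w]; the proof computes directly in entries. *)
Lemma sl2_lie_curvature v w : \tr v = 0 -> \tr w = 0 ->
  2^-1 * \tr ((- 4^-1 *: ((v *m w - w *m v) *m w
                          - w *m (v *m w - w *m v))) *m v)
  = - (2^-1 * \tr (v *m v) * (2^-1 * \tr (w *m w))
       - (2^-1 * \tr (v *m w)) ^+ 2).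
Proof.
have opE (M : 'M[K]_2) i j : (- M) i j = - M i j by rewrite mxE.
have adE (M N : 'M[K]_2) i j : (M + N) i j = M i j + N i j by rewrite mxE.
have scE c (M : 'M[K]_2) i j : (c *: M) i j = c * M i j by rewrite mxE.
move=> /trmx2_eq0 v1 /trmx2_eq0 w1.
rewrite !trmx2E !mulmx2E !scE !adE !opE !mulmx2E !adE !opE !mulmx2E v1 w1.
by field.
Qed.

End Sl2Algebra.

(** * Left-invariant fields and sectional curvature *)

Section ConstantCurvature.
Variables (R : realType) (Q : SLquotient).
Variable D : (SL2 R -> 'M[R[i]]_2) -> (SL2 R -> 'M[R[i]]_2) ->
             SL2 R -> 'M[R[i]]_2.
Hypothesis hD : levi_civita Q D.
Implicit Types (A : SL2 R) (X Y Z : SL2 R -> 'M[R[i]]_2).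

(** Anchoring the field at the point [A] under study presents it as the inclusion of the group times
    a constant matrix, which is immediate to differentiate. *)
Lemma left_invariantE X A : left_invariant X ->
  X = fun B => val B *m (invmx (val A) *m X A).
Proof.
have l1 : left_invariant X -> forall B, X B = val B *m X (SL2_one R).
  move=> lX B; rewrite -lX; congr (X _); apply: val_inj.
  by rewrite /= mulmx1.
move=> lX; apply/funext => B.
by rewrite (l1 lX A) mulKmx ?SL2_unitmx // l1.
Qed.

Lemma dfield_left_invariant X A U : left_invariant X -> tangent A U ->
  dfield X A U = U *m invmx (val A) *m X A.
Proof.
move=> lX tU; rewrite {1}(left_invariantE A lX).
rewrite (dfieldM (@smoothmx_val R) (@smoothmx_cst R _) tU).
by rewrite dfield_cst // mulmx0 add0r dfield_val // mulmxA.
Qed.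

(** For left-invariant fields [dY(X)] is [X A^-1 Y]; subtracting half the symmetrization leaves half
    the antisymmetrization, which is half the bracket. *)
Lemma levi_civita_left_invariant X Y A : vector_field Q X -> vector_field Q Y ->
  left_invariant X -> left_invariant Y -> D X Y A = 2^-1 *: bracket X Y A.
Proof.
move=> vX vY lX lY; rewrite (levi_civitaE hD vX vY) /lc_connection /bracket.
rewrite (dfield_left_invariant lY (vector_field_tangent A vX)).
rewrite (dfield_left_invariant lX (vector_field_tangent A vY)).
exact: half_sub.
Qed.

Lemma curvature_atE A (V1 V2 V3 : 'M[R[i]]_2) :
  curvature_at Q D A V1 V2 V3
    (val A *m (- 4^-1 *: lie (lie (invmx (val A) *m V1) (invmx (val A) *m V2))
                             (invmx (val A) *m V3))).
Proof.
by move=> X Y Z vX vY vZ eX eY eZ; rewrite (curvatureE hD A vX vY vZ) eX eY eZ.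
Qed.

Lemma metric_left_linear A (c : R[i]) (U V W : 'M[R[i]]_2) :
  metric A (c *: U + V) W = c * metric A U W + metric A V W.
Proof.
rewrite !metricE mulmxDr mulmxDl mxtraceD mulrDr -scalemxAr -scalemxAl.
by rewrite mxtraceZ mulrCA.
Qed.

Lemma levi_civita_constant_curvature : constant_sectional_curvature Q D (-1).
Proof.
move=> A P [dP tP ndP] V W sP.
(* The denominator of the sectional curvature is the Gram determinant of [V] and [W], so the final
   quotient is a genuine one. *)
have g0 := @gram_neq0 R[i] 'M[R[i]]_2 (metric A) P V W (@metricC R A)
  (metric_left_linear A) dP sP ndP.
have tV : tangent A V by apply: tP; rewrite -sP memv_span ?mem_head.
have tW : tangent A W by apply: tP; rewrite -sP memv_span // !inE eqxx orbT.
eexists; first exact: curvature_atE.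
have e : metric A (val A *m (- 4^-1 *: lie (lie (invmx (val A) *m V)
    (invmx (val A) *m W)) (invmx (val A) *m W))) V =
  - (sqnorm A V * sqnorm A W - metric A V W ^+ 2).
  rewrite /sqnorm !metricE (mulKmx (SL2_unitmx A)).
  exact: sl2_lie_curvature tV tW.
by rewrite e mulNr mulfV.
Qed.

End ConstantCurvature.

Theorem proposition2p2 (R : realType)
    (D D' : (SL2 R -> 'M[R[i]]_2) -> (SL2 R -> 'M[R[i]]_2) ->
            SL2 R -> 'M[R[i]]_2)
    (hD : levi_civita PSL D) (hD' : levi_civita SL D') :
  [/\ forall X Y : SL2 R -> 'M[R[i]]_2,
        vector_field PSL X -> vector_field PSL Y ->
        left_invariant X -> left_invariant Y ->
        forall A : SL2 R, D X Y A = 2^-1 *: bracket X Y A,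
      forall V1 V2 V3 : 'M[R[i]]_2, sl2 V1 -> sl2 V2 -> sl2 V3 ->
        curvature_at PSL D (SL2_one R) V1 V2 V3
          (- 4^-1 *: lie (lie V1 V2) V3),
      forall V1 V2 : 'M[R[i]]_2, sl2 V1 -> sl2 V2 ->
        sqnorm (SL2_one R) (lie V1 V2) =
        - 4 * sqnorm (SL2_one R) V1 * sqnorm (SL2_one R) V2
        + 4 * metric (SL2_one R) V1 V2 ^+ 2
    & constant_sectional_curvature PSL D (-1) /\
      constant_sectional_curvature SL D' (-1)].
Proof.
have inv1 (M : 'M[R[i]]_2) : invmx (val (SL2_one R)) *m M = M.
  by rewrite /= invmx1 mul1mx.
split.
- by move=> X Y vX vY lX lY A; exact: (levi_civita_left_invariant hD).
- move=> V1 V2 V3 _ _ _.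
  by have := @curvature_atE _ _ _ hD (SL2_one R) V1 V2 V3; rewrite !inv1 mul1mx.
- move=> V1 V2 t1 t2; rewrite /sqnorm !metricE !inv1.
  exact: sl2_lie_sqnorm t1 t2.
- by split; [exact: levi_civita_constant_curvature hD|
             exact: levi_civita_constant_curvature hD'].
Qed.
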